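(* Let $X$ be a complex topological vector space, let $T$ be a continuous linear operator on $X$ and let $x\in X$. The following are equivalent. (i) $x$ is a frequently hypercyclic vector for $T$. (ii) For every polynomial $P\in\mathbb R[t]$ and every nonempty open set $U\subset X$, the set $\{n\in\mathbb N;\ e^{iP(n)}T^n x\in U\}$ has positive lower density. (iii) There exists a polynomial $P\in\mathbb R[t]$ such that, for every nonempty open set $U\subset X$, the set $\{n\in\mathbb N;\ e^{iP(n)}T^n x\in U\}$ has positive lower density.
   Context: The lower density of a set $A$ of natural numbers is $\liminf_{N\to\infty}\frac{\mathrm{card}(A\cap[1,N])}{N}$. A vector $x\in X$ is frequently hypercyclic for a continuous linear operator $T$ on $X$ if for every nonempty open set $U\subset X$ the set $\{n\in\mathbb N;\ T^n x\in U\}$ has positive lower density. *)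

(* Defs.v *)
From HB Require Import structures.
From mathcomp Require Import all_boot all_order all_algebra finmap.
From mathcomp Require Import all_classical all_reals all_analysis.
From mathcomp Require Import complex.

Set Implicit Arguments.
Unset Strict Implicit.
Unset Printing Implicit Defensive.

Import Order.TTheory GRing.Theory Num.Theory.
Import numFieldNormedType.Exports.

Local Open Scope classical_set_scope.
Local Open Scope ring_scope.

(* The term N = 0 is 0 / 0 = 0 and does not affect the limit inferior. *)
Definition lower_density (R : realType) (A : set nat) : \bar R :=
  limn_einf (fun N : nat =>
    ((#|` fset_set (A `&` [set n | (1 <= n <= N)%N])|)%:R / N%:R : R)%:E).

Definition frequently_hypercyclic (R : realType)
    (X : topologicalLmodType R[i]) (T : {linear X -> X}) (x : X) : Prop :=
  forall U : set X, open U -> U !=set0 ->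
    (0 < lower_density R [set n | U (iter n T x)])%E.

Definition expC (R : realType) (z : R[i]) : R[i] :=
  (expR (complex.Re z))%:C%C * (cos (complex.Im z) +i* sin (complex.Im z))%C.

(* Main.v *)
Require Import Defs.
From mathcomp Require Import all_boot all_order all_algebra finmap.
From mathcomp Require Import all_classical all_reals all_analysis.
From mathcomp Require Import complex.
From mathcomp Require Import ring lra zify.

Set Implicit Arguments.
Unset Strict Implicit.
Unset Printing Implicit Defensive.

Import Order.TTheory GRing.Theory Num.Theory.
Import numFieldNormedType.Exports.

Local Open Scope classical_set_scope.
Local Open Scope ring_scope.

(** Frequency is inherited from density by compactness, and density is a
dichotomy settled by the topology of the circle.  Write [cis t] for the
unimodular complex number of argument [t], and call cyclic the vectors
[p(T) x] with [p] a nonzero polynomial.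

_From density to lower density._  Suppose that for every nonempty open [U] and
every real polynomial [Q] of bounded degree some [m] puts
[cis (Q m) *: T^m x] in [U].  Modulo 2 pi the values of [Q] depend only on the
residues of its finite differences at 0, which form a point of a compact torus.
Hence finitely many [m <= N] serve all [Q] at once, and all [y] near [x] in
place of [x] (uniform_return).  Let [n] be a return time of [T^n x] to that
neighbourhood of [x].  With [Q = P (n + _)] some [m <= N] puts
[cis (P (n + m)) *: T^(n+m) x] in [U].  So the good times meet every window
[n, n + N] that starts at a return time, and they have positive lower density
because the return times do (lower_density_translate).  To remove a polynomial
phase, the same argument applies to the return times of
[cis (P n) *: T^n x] and the constant phase [- P n].

_Density._  Two density statements are needed: an orbit that is dense up to
rotations is dense (rotated_dense_orbit_dense), and then every orbit rotated by
a polynomial phase is dense (rotated_orbit_dense).  In both a circle is fibred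
over a system in which every state is known to be reachable from every other.
The rotations by which a state reaches itself form a closed submonoid of the
circle: either the whole circle, and then the extension is transitive as well,
or the [k]-th roots of unity (closed_angle_monoid).  In the second case [k]
times the rotation met on the way from one state to another is a continuous
circle-valued cocycle (circle_cocycle, cocycle_near), and it remains to see
that it cannot exist, or that it is trivial.  This is where linearity enters.
The cyclic vectors that a segment of cyclic vectors joins to [x] form a domain
on which a circle-valued function has a continuous real lift (swept).

For rotations the cocycle would turn [k] times along the loop
[cis s *: T x], whereas its lift returns to its starting value
(rotation_degree).  Every cyclic vector inherits density up to rotations from
[x], because [T - lam] has dense range (rotated_dense_poly).

For polynomial phases the state is a vector together with the sequence of
finite differences of the phase, which one step of time moves by
[th_i := th_i + th_(i+1)].  The coordinates are added one by one, the highest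
difference first, and the induction hypothesis is that reachability is
symmetric and does not see the cyclic vector involved (reversible).  A cocycle
over the states gives a function [r] on the cyclic vectors that is independent
of the phase (cocycle_class) and satisfies [r (T u) = r u + mu].  The lift of
[r] at [T^n x] is [n] times a fixed lift of [mu], and it is small whenever
[T^n x] returns to [x]; thus [mu = 0] (return_eigenphase), [r] vanishes along
a dense orbit, and the cocycle is trivial (cocycle_trivial). *)

(** * Angles modulo a full turn *)

Lemma near2I (U V : Type) (F : set_system U) (G : set_system V) (A : set U)
  (B : set V) (P : U -> V -> Prop) : F A -> G B ->
  (forall u v, A u -> B v -> P u v) -> \forall u \near F & v \near G, P u v.
Proof. by move=> FA GB AB; exists (A, B) => // -[u v] [/= Au Bv]; exact: AB. Qed.

Section Angle.
Variable R : realType.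
Implicit Types (s t u : R) (L : set R).

(** Half the chord between 1 and [cis t]: a distance to the multiples of 2 pi
that makes residues of real numbers usable without a quotient type. *)
Definition ang t : R := `|sin (t / 2)|.

Lemma ang_ge0 t : 0 <= ang t. Proof. exact: normr_ge0. Qed.

Lemma ang0 : ang 0 = 0. Proof. by rewrite /ang mul0r sin0 normr0. Qed.

Lemma angN t : ang (- t) = ang t.
Proof. by rewrite /ang mulNr sinN normrN. Qed.

Lemma angB s t : ang (s - t) = ang (t - s).
Proof. by rewrite -angN opprB. Qed.

Lemma normr_cos_le1 t : `|cos t| <= 1.
Proof. by rewrite ler_norml cos_geN1 cos_le1. Qed.

Lemma ang_le_add s t : ang (s + t) <= ang s + ang t.
Proof.
rewrite /ang mulrDl sinD; apply: (le_trans (ler_normD _ _)).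
by apply: lerD; rewrite normrM; [apply: ler_piMr|apply: ler_piMl];
  rewrite ?normr_cos_le1.
Qed.

Lemma ang_triangle u s t : ang (s - t) <= ang (s - u) + ang (u - t).
Proof. by have := ang_le_add (s - u) (u - t); rewrite addrA subrK. Qed.

Lemma ang_congD s t : ang s = 0 -> ang (s + t) = ang t.
Proof.
move=> s0; apply/eqP; rewrite eq_le; apply/andP; split.
  by have := ang_le_add s t; rewrite s0 add0r.
by have := ang_le_add (- s) (s + t); rewrite addKr angN s0 add0r.
Qed.

Lemma ang_eq0D s t : ang s = 0 -> ang t = 0 -> ang (s + t) = 0.
Proof. by move=> /ang_congD ->. Qed.

Lemma ang_eq0B s t : ang s = 0 -> ang t = 0 -> ang (s - t) = 0.
Proof. by move=> s0 t0; apply: ang_eq0D => //; rewrite angN. Qed.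

Lemma ang_cong s t : ang (s - t) = 0 -> ang s = ang t.
Proof. by move=> st; rewrite -(@ang_congD (s - t) t) // subrK. Qed.

Lemma ang_eq0_mulrz (k : int) t : ang t = 0 -> ang (k%:~R * t) = 0.
Proof.
move=> t0; have nat0 n : ang (n%:R * t) = 0.
  elim: n => [|n IHn]; first by rewrite mul0r ang0.
  by rewrite -natr1 mulrDl mul1r ang_eq0D.
case: k => n; first exact: nat0.
by rewrite NegzE mulrNz mulNr angN; exact: nat0.
Qed.

Lemma ang_2pi : ang (pi *+ 2) = 0.
Proof. by rewrite /ang -[pi *+ 2]mulr_natr mulfK // sinpi normr0. Qed.

Lemma pi2_gt0 : 0 < pi *+ 2 :> R.
Proof. by rewrite mulrn_wgt0 // pi_gt0. Qed.

Lemma mod_reduce d t : 0 < d ->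
  exists k : int, 0 <= t - k%:~R * d < d.
Proof.
move=> d0; exists (Num.floor (t / d)).
have /andP[] := floor_itv (t / d).
rewrite ler_pdivlMr // ltr_pdivrMr // intrD mulrDl mul1r => h1 h2.
by rewrite subr_ge0 h1 ltrBlDl.
Qed.

Lemma ang_gt0 t : 0 < t < pi *+ 2 -> 0 < ang t.
Proof.
move=> /andP[t0 t2]; rewrite /ang normr_gt0 gt_eqF // sin_gt0_pi //.
by rewrite divr_gt0 //= ltr_pdivrMr // mulr_natr.
Qed.

Lemma ang_eq0P t : ang t = 0 <-> exists k : int, t = k%:~R * (pi *+ 2).
Proof.
split=> [t0|[k ->]]; last by rewrite ang_eq0_mulrz // ang_2pi.
have [k /andP[k0 k2]] := mod_reduce t pi2_gt0.
exists k; apply/eqP; rewrite -subr_eq0; apply/negPn/negP => tn0.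
suff : 0 < ang (t - k%:~R * (pi *+ 2)).
  by rewrite ang_eq0B ?ltxx // ang_eq0_mulrz // ang_2pi.
by apply: ang_gt0; rewrite lt_neqAle eq_sym tn0 k0.
Qed.

Lemma ang_near t e : 0 < e -> \forall s \near t, ang (s - t) < e.
Proof.
move=> e0; have ct : ang (s - t) @[s --> t] --> ang (t - t).
  apply: cvg_norm; apply: (@continuous_comp _ _ _ (fun s => (s - t) / 2) sin).
    by apply: cvgMl; apply: cvgB; [exact: cvg_id|exact: cvg_cst].
  exact: continuous_sin.
by apply: (@cvgr_lt _ _ _ _ _ _ ct); rewrite subrr ang0.
Qed.

Lemma sin_dist_le s t : `|sin s - sin t| <= 2 * ang (s - t).
Proof.
pose m := (s + t) / 2; pose d := (s - t) / 2.
have -> : s = m + d by rewrite /m /d; field.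
have -> : t = m - d by rewrite /m /d; field.
rewrite /ang !sinD sinN cosN.
have -> : m + d - (m - d) = d * 2 by ring.
rewrite mulfK //.
have -> : sin m * cos d + cos m * sin d - (sin m * cos d + cos m * - sin d) =
  2 * (cos m * sin d) by ring.
rewrite normrM ger0_norm // ler_pM2l // normrM ler_piMl //.
exact: normr_cos_le1.
Qed.

Lemma cosE_ang t : cos t = 1 - 2 * ang t ^+ 2.
Proof.
rewrite /ang real_normK ?num_real //.
have {1}-> : t = t / 2 + t / 2 by field.
by rewrite cosD -!expr2 cos2sin2; ring.
Qed.

(** The principal representative of [t] modulo 2 pi when [t] is close to a
multiple of 2 pi.  Clamping the sine inside ]-1, 1[ keeps the function
continuous at every angle. *)
Definition princ t : R := asin (Num.max (- 2^-1) (Num.min 2^-1 (sin t))).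

(** For [ang t < 1 / 4] the clamping is inactive and the cosine is positive, so
the arcsine recovers both the sine and the cosine of [t]. *)
Lemma princ_cong t : ang t < 4^-1 -> ang (princ t - t) = 0.
Proof.
move=> t4; have := sin_dist_le t 0; rewrite sin0 !subr0 => st.
have st2 : `|sin t| <= 2^-1 by apply: (le_trans st); lra.
have /andP[s1 s2] : - 2^-1 <= sin t <= 2^-1 by rewrite -ler_norml.
rewrite /princ min_r // max_r //.
have st1 : -1 <= sin t <= 1 by rewrite sin_geN1 sin_le1.
have c0 : 0 < cos t.
  by rewrite cosE_ang; have := ang_ge0 t; nra.
have cE : cos (asin (sin t)) = cos t.
  by rewrite cos_asin // -cos2sin2 sqrtr_sqr ger0_norm // ltW.
have : cos (asin (sin t) - t) = 1.
  rewrite cosD cosN sinN cE asinK ?in_itv //=.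
  by rewrite -[RHS](cos2Dsin2 t); ring.
rewrite cosE_ang => /eqP; rewrite -subr_eq0 addrAC subrr add0r oppr_eq0.
by rewrite mulf_eq0 pnatr_eq0 /= expf_eq0 /= => /eqP.
Qed.

Lemma asin0 : asin 0 = 0 :> R.
Proof.
by rewrite -[in LHS]sin0 sinK // in_itv /= oppr_le0 divr_ge0 // pi_ge0.
Qed.

Lemma princ_continuous_sin (T : topologicalType) (f : T -> R) z :
  {for z, continuous (sin \o f)} -> {for z, continuous (princ \o f)}.
Proof.
move=> cf.
apply: (@continuous_comp _ _ _
  (fun z' => Num.max (- 2^-1) (Num.min 2^-1 (sin (f z')))) asin).
  apply: (@continuous_max _ _ (cst _) (fun z' => Num.min 2^-1 (sin (f z')))).
    exact: cvg_cst.
  by apply: (@continuous_min _ _ (cst _) (fun z' => sin (f z')));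
    first exact: cvg_cst.
apply: continuous_asin.
have l1 : -1 < - 2^-1 :> R by lra.
have l2 : 2^-1 < 1 :> R by lra.
have l3 : - 2^-1 < 1 :> R by lra.
by rewrite lt_max l1 /= gt_max l3 gt_min l2.
Qed.

Lemma princ_small e : 0 < e ->
  exists2 d, 0 < d & forall t, ang t < d -> `|princ t| < e.
Proof.
move=> e0.
have ca : asin x @[x --> (0 : R)] --> 0.
  by rewrite -[X in _ --> X]asin0; apply: continuous_asin; lra.
have /cvgr0_norm_lt /(_ e e0) /nbhs_ballP[d /= d0 hd] := ca.
exists (Num.min (d / 2) 4^-1); first by rewrite lt_min divr_gt0 //= invr_gt0.
move=> t; rewrite lt_min => /andP[td t4].
have := sin_dist_le t 0; rewrite sin0 !subr0 => st.
have /andP[s1 s2] : - 2^-1 <= sin t <= 2^-1.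
  by rewrite -ler_norml; apply: (le_trans st); lra.
rewrite /princ min_r // max_r //; apply: hd.
by rewrite -ball_normE /= sub0r normrN; apply: (le_lt_trans st); lra.
Qed.

(** Continuity modulo 2 pi is enough, since [princ] only sees a sine. *)
Lemma princ_continuous_comp (T : topologicalType) (f : T -> R) :
  (forall z e, 0 < e -> \forall z' \near z, ang (f z' - f z) < e) ->
  continuous (princ \o f).
Proof.
move=> cf z; apply: princ_continuous_sin; apply/cvgrPdist_lt => e e0.
have e2 : 0 < e / 2 by rewrite divr_gt0.
apply: filterS (cf z _ e2) => z' hz'.
by rewrite distrC; apply: (le_lt_trans (sin_dist_le _ _)); lra.
Qed.

Lemma ang_reduce t : exists2 s, ang (s - t) = 0 & 0 <= s <= pi *+ 2.
Proof.
have [k /andP[k0 k2]] := mod_reduce t pi2_gt0.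
exists (t - k%:~R * (pi *+ 2)); last by rewrite k0 ltW.
rewrite addrAC subrr add0r angN.
by apply: ang_eq0_mulrz; exact: ang_2pi.
Qed.

(** Closed submonoids of the circle are its closed subgroups.  Let [a] be the
infimum of the positive elements.  If [a = 0] the multiples of small elements
are dense.  Otherwise [a] belongs to [L] and no element lies in ]0, a[, so a
full turn is a multiple [k a] and [L] consists of the multiples of [a]; the
inverses come for free, as [- a] is [(k - 1) a] up to a full turn. *)
Lemma closed_angle_monoid L :
  (forall t, (forall e, 0 < e -> exists2 s, L s & ang (s - t) < e) -> L t) ->
  L 0 -> (forall s t, L s -> L t -> L (s + t)) ->
  (forall t, L t) \/
  exists2 k : nat, (0 < k)%N & forall t, L t <-> ang (k%:R * t) = 0.
Proof.
move=> Lcl L0 LD.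
have Lper t s : L s -> ang (s - t) = 0 -> L t.
  by move=> Ls st; apply: Lcl => e e0; exists s => //; rewrite st.
have LM n t : L t -> L (n%:R * t).
  move=> Lt; elim: n => [|n IHn]; first by rewrite mul0r.
  by rewrite -natr1 mulrDl mul1r; apply: LD.
pose P := [set t | 0 < t /\ L t].
have P2pi : P (pi *+ 2).
  split; first exact: pi2_gt0.
  by apply: (Lper _ 0) => //; rewrite sub0r angN ang_2pi.
have hP : has_inf P by split; [exists (pi *+ 2)|exists 0 => y [/ltW]].
set a := inf P.
have a_ge0 : 0 <= a by apply: lb_le_inf; [exists (pi *+ 2)|move=> y [/ltW]].
have Papprox e : 0 < e -> exists2 t, P t & t < a + e.
  by move=> e0; have [t Pt tl] := inf_adherent e0 hP; exists t.
have [a0|a_n0] := eqVneq a 0.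
  left=> t; apply: Lcl => e e0.
  (* multiples of a small positive element come close to every angle *)
  have /nbhs_ballP[d /= d0 hd] := ang_near t e0.
  have [u [u0 Lu]] := Papprox _ d0; rewrite a0 add0r => ud.
  have [j /andP[j1 j2]] := mod_reduce t pi2_gt0.
  set t' := t - _ in j1 j2.
  have [k /andP[k1 k2]] := mod_reduce t' u0.
  have k_ge0 : (0 <= k)%R.
    rewrite leNgt; apply/negP => kn.
    have : (k + 1)%:~R <= (0 : R) by rewrite lerz0 -ltzD1 ltrD2r.
    by rewrite intrD; nra.
  exists (k%:~R * u); first by case: k k_ge0 {k1 k2} => // n _; exact: LM.
  suff -> : ang (k%:~R * u - t) = ang (t + (k%:~R * u - t') - t).
    apply: hd; rewrite -ball_normE /= opprD addrA subrr add0r opprB.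
    by rewrite ger0_norm //; apply: lt_trans ud.
  apply: ang_cong.
  have -> : k%:~R * u - t - (t + (k%:~R * u - t') - t) = t' - t by ring.
  by rewrite /t' addrAC subrr add0r angN ang_eq0_mulrz // ang_2pi.
right; have a_gt0 : 0 < a by rewrite lt_neqAle eq_sym a_n0.
have La : L a.
  apply: Lcl => e e0; have /nbhs_ballP[d /= d0 hd] := ang_near a e0.
  have [u Pu ud] := Papprox _ d0; exists u; first exact: Pu.2.
  apply: hd; rewrite -ball_normE /= ltr_distlC; apply/andP; split=> //.
  by apply: (@lt_le_trans _ _ a); [lra|exact: ge_inf hP.2 _ Pu].
have Lsmall t : L t -> 0 <= t < a -> t = 0.
  move=> Lt /andP[t0 ta]; apply/eqP; rewrite -[_ == _]negbK; apply/negP => tn0.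
  suff : a <= t by rewrite leNgt ta.
  by apply: ge_inf hP.2 _ _; split => //; rewrite lt_neqAle eq_sym tn0.
have LB2pi t (k : int) : L t -> L (t + k%:~R * (pi *+ 2)).
  move=> Lt; apply: (Lper _ t) => //.
  by rewrite opprD addrA subrr add0r angN ang_eq0_mulrz // ang_2pi.
have [j /andP[j1 j2]] := mod_reduce (- (pi *+ 2)) a_gt0.
have j_lt0 : (j < 0)%R.
  by rewrite -(ltrz0 R) -(pmulr_llt0 _ a_gt0); have := pi2_gt0; lra.
have jE : j%:~R = - (`|j|%N)%:R :> R.
  have {1}-> : j = - (`|j|%N)%:Z by lia.
  by rewrite mulrNz.
have ka : (`|j|%N)%:R * a = pi *+ 2.
  apply/eqP; rewrite -subr_eq0; apply/eqP; apply: Lsmall; last first.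
    by move: j1 j2; rewrite jE mulNr opprK addrC => -> ->.
  by have := LB2pi _ (-1) (LM `|j|%N _ La); rewrite mulN1r.
set k := `|j|%N in ka jE.
have k_gt0 : (0 < k)%N by rewrite /k; lia.
exists k => //.
have LNa : L (- a).
  have -> : - a = (k.-1)%:R * a + (-1)%:~R * (pi *+ 2).
    by rewrite -ka -[in k%:R](prednK k_gt0) -natr1; ring.
  by apply: LB2pi; exact: LM.
have Laz (m : int) : L (m%:~R * a).
  case: m => n; first exact: LM.
  by rewrite NegzE mulrNz mulNr -mulrN; exact: LM.
move=> t; split=> [Lt|/ang_eq0P[m mE]].
  have [m mP] := mod_reduce t a_gt0.
  have : t - m%:~R * a = 0.
    apply: Lsmall => //.
    by have := LD _ _ Lt (Laz (- m)); rewrite mulrNz mulNr.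
  move=> /eqP; rewrite subr_eq0 => /eqP ->.
  by rewrite mulrCA ka ang_eq0_mulrz // ang_2pi.
suff -> : t = m%:~R * a by [].
have k0 : k%:R != 0 :> R by rewrite pnatr_eq0 -lt0n.
by apply: (mulfI k0); rewrite mE -ka; ring.
Qed.
End Angle.

(** * Circle-valued cocycles *)

Section Cocycle.
Variables (R : realType) (S : Type) (D : set S) (A : S -> R -> S -> Prop).
Hypothesis Acl : forall p t q, D p -> D q ->
  (forall e, 0 < e -> exists2 s, A p s q & ang (s - t) < e) -> A p t q.
Hypothesis A0 : forall p, D p -> A p 0 p.
Hypothesis AD : forall p s q t w, D p -> D q -> D w ->
  A p s q -> A q t w -> A p (s + t) w.
Hypothesis Aex : forall p q, D p -> D q -> exists t, A p t q.

(** [A p t q] is meant as: rotating by [t], the state [q] can be reached from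
[p].  The self-rotations of one state [p0] decide for all pairs, since any path
from [p] to [q] can be completed to a loop at [p0]. *)
Lemma circle_cocycle :
  (forall p t q, D p -> D q -> A p t q) \/
  exists2 k : nat, (0 < k)%N & exists F : S -> S -> R,
    forall p q t, D p -> D q -> (A p t q <-> ang (k%:R * t - F p q) = 0).
Proof.
have [[p0 Dp0]|nD0] := pselect (exists p0, D p0); last first.
  by left=> p t q Dp; case: nD0; exists p.
have [out outP] : {f : S -> R & forall q, D q -> A p0 (f q) q}.
  apply: (@choice _ _ (fun q t => D q -> A p0 t q)) => q.
  by have [Dq|nDq] := pselect (D q); [have [t] := Aex Dp0 Dq; exists t|exists 0].
have [back backP] : {f : S -> R & forall q, D q -> A q (f q) p0}.
  apply: (@choice _ _ (fun q t => D q -> A q t p0)) => q.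
  by have [Dq|nDq] := pselect (D q); [have [t] := Aex Dq Dp0; exists t|exists 0].
have [Lall|[k k0 Lk]] := @closed_angle_monoid R [set t | A p0 t p0]
  (fun t => @Acl p0 t p0 Dp0 Dp0) (A0 Dp0) (fun s t => @AD p0 s p0 t p0 Dp0 Dp0 Dp0).
- left=> p t q Dp Dq.
  have -> : t = back p + (t - back p - out q) + out q by ring.
  apply: (AD Dp Dp0 Dq); last exact: outP.
  by apply: (AD Dp Dp0 Dp0); [exact: backP|exact: Lall].
right; exists k => //; exists (fun p q => - k%:R * (out p + back q)) => p q t Dp Dq.
have -> : k%:R * t - - k%:R * (out p + back q) = k%:R * (out p + t + back q) by ring.
split=> [Apq|/Lk/= Ao].
  apply/Lk => /=; apply: (AD Dp0 Dq Dp0); last exact: backP.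
  by apply: (AD Dp0 Dp Dq) => //; exact: outP.
have inv s : A p0 s p0 -> A p0 (- s) p0.
  by move=> /Lk sk; apply/Lk; rewrite mulrN angN.
have -> : t = back p + - (out p + back p) + (out p + t + back q) +
    - (out q + back q) + out q.
  by ring.
apply: (AD Dp Dp0 Dq); last exact: outP.
apply: (AD Dp Dp0 Dp0); last first.
  by apply: inv; apply: (AD Dp0 Dq Dp0); [exact: outP|exact: backP].
apply: (AD Dp Dp0 Dp0); last by [].
apply: (AD Dp Dp0 Dp0); first exact: backP.
by apply: inv; apply: (AD Dp0 Dp Dp0); [exact: outP|exact: backP].
Qed.

Variables (k : nat) (F : S -> S -> R).
Hypothesis k_gt0 : (0 < k)%N.
Hypothesis AF : forall p q t, D p -> D q ->
  (A p t q <-> ang (k%:R * t - F p q) = 0).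

Lemma cocycle_attained p q : D p -> D q ->
  exists2 t, A p t q & ang (k%:R * t - F p q) = 0.
Proof.
move=> Dp Dq; have k0 : k%:R != 0 :> R by rewrite pnatr_eq0 -lt0n.
have h : ang (k%:R * (F p q / k%:R) - F p q) = 0.
  by rewrite mulrCA divff // mulr1 subrr ang0.
by exists (F p q / k%:R) => //; apply/AF.
Qed.

Lemma cocycle_add p q w : D p -> D q -> D w ->
  ang (F p q + F q w - F p w) = 0.
Proof.
move=> Dp Dq Dw; have [s Apq sE] := cocycle_attained Dp Dq.
have [t Aqw tE] := cocycle_attained Dq Dw.
have /(AF _ Dp Dw) := AD Dp Dq Dw Apq Aqw.
rewrite -(@ang_cong _ (F p q + F q w - F p w)) //.
have -> : F p q + F q w - F p w - (k%:R * (s + t) - F p w) =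
  - (k%:R * s - F p q) - (k%:R * t - F q w) by ring.
by rewrite ang_eq0B ?angN.
Qed.

(** A closed graph in a compact target: the rotations whose [k]-th multiple is
far from [F p q] form a compact set, and none of them reaches a state close to
[q].  Neighbourhoods of states are given by a filter, as states need not form a
topological space. *)
Lemma cocycle_near (N : set_system S) {FN : Filter N} p q : D p -> D q ->
  (forall t, ~ A p t q -> exists2 e, 0 < e &
     \forall q' \near N, forall t', ang (t' - t) < e -> ~ A p t' q') ->
  forall e, 0 < e -> \forall q' \near N, D q' -> ang (F p q' - F p q) < e.
Proof.
move=> Dp Dq Ncl e e0.
have /compact_near_coveringP cov := @segment_compact R 0 (pi *+ 2).
pose P q' t := A p t q' -> ang (k%:R * t - F p q) < e.
have hP t : `[0, pi *+ 2]%classic t -> \forall t' \near t & q' \near N, P q' t'.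
  move=> _.
  have [tF|tF] := ltP (ang (k%:R * t - F p q)) e.
    have c : 0 < e - ang (k%:R * t - F p q) by rewrite subr_gt0.
    have kt : k%:R * s @[s --> t] --> k%:R * t by apply: cvgMr; exact: cvg_id.
    have nt : \forall s \near t, ang (k%:R * s - F p q) < e.
      have : \forall s \near t, ang (k%:R * s - k%:R * t) <
        e - ang (k%:R * t - F p q) by exact: kt _ (ang_near _ c).
      apply: filterS => s hs.
      have := ang_triangle (k%:R * t) (k%:R * s) (F p q); lra.
    by apply: (near2I nt filterT) => s q' hs _ _.
  have nA : ~ A p t q by move=> /AF -/(_ Dp Dq) tE; move: tF; rewrite tE leNgt e0.
  have [d d0 Hd] := Ncl _ nA.
  by apply: (near2I (ang_near t d0) Hd) => s q' sd /(_ _ sd) nAs /nAs.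
apply: filterS (cov S N P FN hP) => q' hq' Dq'.
have [t Apq' tF] := cocycle_attained Dp Dq'.
have [s st s02] := ang_reduce t.
have kst : ang (k%:R * (s - t)) = 0 by exact: (@ang_eq0_mulrz _ k).
have sF : ang (k%:R * s - F p q') = 0.
  rewrite -tF; apply: ang_cong.
  by have -> : k%:R * s - F p q' - (k%:R * t - F p q') = k%:R * (s - t) by ring.
have := hq' s; rewrite /= in_itv /= => /(_ s02).
have /AF -/(_ Dp Dq') As := sF.
move=> /(_ As).
have := ang_triangle (k%:R * s) (F p q') (F p q).
by rewrite (angB _ (k%:R * s)) sF add0r; exact: le_lt_trans.
Qed.
End Cocycle.

(** * Lifting angle-valued paths *)

Section Lift.
Variable R : realType.
Implicit Types (h L : R -> R) (t e : R).

Definition ang_continuous h :=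
  forall t e, 0 < e -> \forall s \near t, ang (h s - h t) < e.

Definition lifts L h :=
  continuous L /\ forall t, 0 <= t <= 1 -> ang (L t - h t) = 0.

(** By the intermediate value theorem a nonconstant continuous function would
take a value strictly between two consecutive points of the residue class. *)
Lemma ang_locally_constant L : continuous L ->
  (forall t, 0 <= t <= 1 -> ang (L t - L 0) = 0) -> L 1 = L 0.
Proof.
suff noincr (M : R -> R) : continuous M ->
    (forall t, 0 <= t <= 1 -> ang (M t - M 0) = 0) -> M 1 <= M 0.
  move=> cL L0; apply/eqP; rewrite eq_le; apply/andP; split; first exact: noincr.
  have := noincr (fun t => - L t); rewrite lerN2; apply.
    by move=> t; apply: cvgN; exact: cL.
  by move=> t /L0; rewrite -opprD angN.
move=> cM M0; rewrite leNgt; apply/negP => lt01.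
pose v := Num.min (M 1) (M 0 + pi).
have p0 := @pi_gt0 R.
have v0 : M 0 < v by rewrite lt_min lt01 ltrDl.
have v1 : v <= M 1 by rewrite ge_min lexx.
have v2 : v <= M 0 + pi by rewrite ge_min lexx orbT.
have [||c c01 cv] := @IVT R M 0 1 v ler01.
- by apply: continuous_subspaceT => t; exact: cM.
- by rewrite ge_min (ltW v0) /= le_max v1 orbT.
have := M0 c; rewrite in_itv /= in c01 => /(_ c01); rewrite cv.
have /ang_gt0/lt0r_neq0/eqP : 0 < v - M 0 < pi *+ 2 by rewrite mulr2n; lra.
by [].
Qed.

Lemma ang_uniform h e : ang_continuous h -> 0 < e ->
  exists2 d, 0 < d &
    forall s t, 0 <= t <= 1 -> `|s - t| < d -> ang (h s - h t) < e.
Proof.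
move=> ch e0; have e2 : 0 < e / 2 by rewrite divr_gt0.
have /compact_near_coveringP cov := @segment_compact R 0 1.
pose P (d t : R) := forall s, `|s - t| < `|d| -> ang (h s - h t) < e.
have hP t : `[0, 1]%classic t -> \forall t' \near t & d \near (0 : R), P d t'.
  move=> _; have /nbhs_ballP[r /= r0 hr] := ch t _ e2.
  have r2 : 0 < r / 2 by rewrite divr_gt0.
  apply: (near2I (nbhsx_ballx t _ r2) (nbhsx_ballx 0 _ r2)) => t' d.
  rewrite -!ball_normE /= sub0r normrN => t'r dr s st'.
  have hs : ang (h s - h t) < e / 2.
    apply: hr; rewrite -ball_normE /= -[t - s](subrKA t').
    by rewrite (le_lt_trans (ler_normD _ _)) // [X in _ + X]distrC; lra.
  have ht' : ang (h t' - h t) < e / 2.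
    by apply: hr; rewrite -ball_normE /=; lra.
  by have := ang_triangle (h t) (h s) (h t'); rewrite (angB (h t)); lra.
have : \forall d \near (0 : R), `[0, 1]%classic `<=` P d by exact: cov hP.
move=> /nbhs_ballP[r /= r0 hr].
have r2 : 0 < r / 2 by rewrite divr_gt0.
exists (r / 2) => // s t t01 st.
have := hr (r / 2); rewrite -ball_normE /= sub0r normrN (gtr0_norm r2).
move=> /(_ _ t); rewrite /= in_itv /= => -> //; first lra.
by rewrite (gtr0_norm r2).
Qed.

(** The path [s |-> h (s t)] from 0 to [t] is cut into [N] pieces so short that
the principal representatives of the increments add up to a lift. *)
Lemma lift_exists h : ang_continuous h -> exists L, lifts L h.
Proof.
move=> ch; have [d d0 hd] := ang_uniform ch (ltac:(by rewrite invr_gt0) : 0 < 4^-1).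
pose N := (Num.truncn d^-1).+1.
have N0 : 0 < N%:R :> R by rewrite ltr0n.
have Nd : N%:R^-1 < d.
  by rewrite -[d]invrK ltf_pV2 ?posrE ?invr_gt0 // truncnS_gt.
pose q (j : nat) t := h (j.+1%:R / N%:R * t) - h (j%:R / N%:R * t).
exists (fun t => h 0 + \sum_(j < N) princ (q j t)); split=> [t|t /andP[t0 t1]].
  apply: cvgD; first exact: cvg_cst.
  apply: cvg_big => [|j _]; first exact: add_continuous.
  apply: (@princ_continuous_comp _ _ (q j)) => {}t e e0.
  have e2 : 0 < e / 2 by rewrite divr_gt0.
  have near_lin (c : R) : \forall s \near t, ang (h (c * s) - h (c * t)) < e / 2.
    have : c * s @[s --> t] --> c * t by apply: cvgMr; exact: cvg_id.
    by move=> /(_ _ (ch (c * t) _ e2)).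
  apply: filterS2 (near_lin (j.+1%:R / N%:R)) (near_lin (j%:R / N%:R)) => s h1 h2.
  have := ang_le_add (h (j.+1%:R / N%:R * s) - h (j.+1%:R / N%:R * t))
    (- (h (j%:R / N%:R * s) - h (j%:R / N%:R * t))).
  rewrite angN => hx.
  have -> : q j s - q j t = (h (j.+1%:R / N%:R * s) - h (j.+1%:R / N%:R * t)) +
    - (h (j%:R / N%:R * s) - h (j%:R / N%:R * t)) by rewrite /q; ring.
  by apply: (le_lt_trans hx); lra.
have -> : h t = h (N%:R / N%:R * t) by rewrite divff ?mul1r // gt_eqF.
suff main n : (n <= N)%N ->
  ang (h 0 + \sum_(j < n) princ (q j t) - h (n%:R / N%:R * t)) = 0 by exact: main.
elim: n => [_|n IHn nN].
  by rewrite big_ord0 !mul0r addr0 subrr ang0.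
have qn : ang (q n t) < 4^-1.
  apply: hd.
    rewrite mulr_ge0 ?divr_ge0 //= mulr_ile1 ?divr_ge0 //.
    by rewrite ler_pdivrMr // mul1r ler_nat ltnW.
  rewrite -mulrBl -mulrBl -natr1 addrAC subrr add0r mul1r normrM.
  rewrite !ger0_norm ?invr_ge0 //; apply: le_lt_trans Nd.
  by rewrite ler_piMr ?invr_ge0.
rewrite big_ord_recr /=; apply: etrans (ang_eq0D (IHn (ltnW nN)) (princ_cong qn)).
by congr ang; rewrite /q; ring.
Qed.

Lemma lift_unique h L L' : lifts L h -> lifts L' h -> L 1 - L 0 = L' 1 - L' 0.
Proof.
move=> [cL Lh] [cL' Lh'].
suff : L 1 - L' 1 = L 0 - L' 0 by lra.
apply: (@ang_locally_constant (fun t => L t - L' t)).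
  by move=> t; apply: cvgB; [exact: cL|exact: cL'].
have LL' t : 0 <= t <= 1 -> ang (L t - L' t) = 0.
  move=> t01; rewrite -(ang_eq0B (Lh t t01) (Lh' t t01)).
  by congr ang; ring.
by move=> t t01; rewrite ang_eq0B ?LL' // lexx ler01.
Qed.

(** The total real increment of an angle-valued path on [0, 1]. *)
Definition turn h : R :=
  xget 0 [set y | exists2 L, lifts L h & y = L 1 - L 0].

Lemma turnE h L : lifts L h -> turn h = L 1 - L 0.
Proof.
move=> Lh; rewrite /turn; case: xgetP => [_ -> [L' Lh' ->]|/(_ (L 1 - L 0))].
  exact: lift_unique Lh' Lh.
by case; exists L.
Qed.

Lemma turn_cong h : ang_continuous h -> ang (turn h - (h 1 - h 0)) = 0.
Proof.
move=> /lift_exists[L Lh]; rewrite (turnE Lh); case: Lh => _ Lh.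
have := ang_eq0B (Lh 1 _) (Lh 0 _); rewrite !lexx ler01 => /(_ erefl erefl).
apply: etrans; congr ang; ring.
Qed.

(** If [h'] is close to [h] then [L + princ (h' - h)] lifts [h'] whenever [L]
lifts [h]. *)
Lemma turn_close e : 0 < e -> exists2 d, 0 < d & forall h h',
  ang_continuous h -> ang_continuous h' ->
  (forall t, 0 <= t <= 1 -> ang (h' t - h t) < d) ->
  `|turn h' - turn h| < e.
Proof.
move=> e0; have e2 : 0 < e / 2 by rewrite divr_gt0.
have [d d0 hd] := princ_small e2.
exists (Num.min d 4^-1); first by rewrite lt_min d0 /= invr_gt0.
move=> h h' ch ch' hh'; have [L Lh] := lift_exists ch.
pose g t := h' t - h t.
have Lh' : lifts (fun t => L t + princ (g t)) h'.
  split=> [t|t t01].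
    apply: cvgD; first exact: Lh.1.
    apply: (@princ_continuous_comp _ _ g) => {}t r r0.
    have r2 : 0 < r / 2 by rewrite divr_gt0.
    apply: filterS2 (ch t _ r2) (ch' t _ r2) => s hs hs'.
    have := ang_le_add (h' s - h' t) (- (h s - h t)); rewrite angN => hl.
    have -> : g s - g t = (h' s - h' t) + - (h s - h t) by rewrite /g; ring.
    by apply: (le_lt_trans hl); lra.
  have := hh' t t01; rewrite lt_min => /andP[_ /princ_cong gt].
  apply: etrans (ang_eq0D (Lh.2 t t01) gt).
  by congr ang; rewrite /g; ring.
rewrite (turnE Lh) (turnE Lh').
have -> : L 1 + princ (g 1) - (L 0 + princ (g 0)) - (L 1 - L 0) =
  princ (g 1) - princ (g 0) by ring.
have small t : 0 <= t <= 1 -> `|princ (g t)| < e / 2.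
  by move=> /hh'; rewrite lt_min => /andP[/hd].
have := small 1; have := small 0; rewrite !lexx ler01 => /(_ erefl) s0 /(_ erefl) s1.
by apply: (le_lt_trans (ler_normB _ _)); lra.
Qed.

Lemma turn_cst (c : R) : turn (fun=> c) = 0.
Proof.
rewrite (@turnE _ (fun=> c)) ?subrr //; split; first by move=> t; exact: cvg_cst.
by move=> t _; rewrite subrr ang0.
Qed.
End Lift.

(** * Unimodular scalars and topological modules *)

Section Cis.
Variable R : realType.
Implicit Types (s t : R).

Definition cis t : R[i] := (cos t +i* sin t)%C.

Lemma cis0 : cis 0 = 1. Proof. by rewrite /cis cos0 sin0. Qed.

Lemma cisD s t : cis (s + t) = cis s * cis t.
Proof.
rewrite /cis cosD sinD; apply/eqP; rewrite eq_complex /=.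
by rewrite eqxx /= addrC [cos s * _]mulrC [sin s * cos t]mulrC [cos t * _]mulrC.
Qed.

Lemma normc_cis t : `|cis t| = 1.
Proof. by rewrite normc_def /= cos2Dsin2 sqrtr1. Qed.

Lemma cis_ang s t : ang (s - t) = 0 -> cis s = cis t.
Proof.
move=> st; have dE : cis (s - t) = 1.
  have c1 : cos (s - t) = 1 by rewrite cosE_ang st; ring.
  have s1 : sin (s - t) = 0.
    apply/eqP; rewrite -sqrf_eq0 sin2cos2 c1; apply/eqP; ring.
  by rewrite /cis c1 s1.
by rewrite -[s](subrK t) cisD dE mul1r.
Qed.

Lemma cisN_mul t : cis (- t) * cis t = 1.
Proof. by rewrite -cisD addNr cis0. Qed.

Lemma cvg_complex (T : Type) (F : set_system T) {FF : Filter F} (f g : T -> R)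
    (a b : R) : f @ F --> a -> g @ F --> b ->
  ((f x +i* g x)%C : R[i]^o) @[x --> F] --> ((a +i* b)%C : R[i]^o).
Proof.
move=> fa gb; apply/cvgrPdist_lt => e e0.
have eE : e = (complex.Re e)%:C%C by rewrite RRe_real // gtr0_real.
have : 0 < (complex.Re e)%:C%C by rewrite -eE.
rewrite ltcR => e1; have e2 : 0 < complex.Re e / 2 by rewrite divr_gt0.
have /cvgrPdist_lt /(_ _ e2) fa' := fa.
have /cvgrPdist_lt /(_ _ e2) gb' := gb.
apply: filterS2 fa' gb' => x xa xb.
rewrite [X in `|X|](complexE _) eE; apply: (le_lt_trans (ler_normD _ _)).
rewrite normrM !normc_def /= !expr0n /= !(addr0, add0r) expr1n sqrtr1 mul1r !sqrtr_sqr.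
by rewrite -rmorphD /= ltcR; lra.
Qed.

Lemma cis_continuous : continuous (cis : R -> R[i]^o).
Proof.
by move=> t; apply: cvg_complex; [exact: continuous_cos|exact: continuous_sin].
Qed.
End Cis.

Section TopologicalModule.
Variables (R : realType) (X : topologicalLmodType R[i]).

Lemma cvgXD (I : Type) (F : set_system I) {FF : Filter F} (f g : I -> X)
    (a b : X) : f @ F --> a -> g @ F --> b -> (f x + g x) @[x --> F] --> a + b.
Proof.
by move=> fa gb; apply: continuous2_cvg => //; exact: (@add_continuous X (a, b)).
Qed.

Lemma cvgXZ (I : Type) (F : set_system I) {FF : Filter F} (c : I -> R[i]^o)
    (f : I -> X) (c0 : R[i]^o) (a : X) : c @ F --> c0 -> f @ F --> a ->
  (c x *: f x) @[x --> F] --> c0 *: a.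
Proof.
move=> cc fa.
apply: (@continuous2_cvg I R[i]^o X X F FF c f
  (fun (k : R[i]^o) (v : X) => k *: v) c0 a) => //.
exact: (@scale_continuous _ X (c0, a)).
Qed.

Lemma cvgXZr (I : Type) (F : set_system I) {FF : Filter F} (c : R[i])
    (f : I -> X) (a : X) : f @ F --> a -> (c *: f x) @[x --> F] --> c *: a.
Proof. by apply: cvgXZ; exact: cvg_cst. Qed.

(** A substitute for balanced neighbourhoods of 0. *)
Lemma nbhs0_disk (W : set X) : nbhs 0 W ->
  exists2 V, nbhs 0 V & forall (c : R[i]) v, `|c| <= 1 -> V v -> W (c *: v).
Proof.
move=> W0; have := @scale_continuous _ X (0, 0); rewrite /continuous_at /= scale0r.
move=> /(_ W W0) [[A V] [/= /nbhs_ballP[e /= e0 eA] V0] AV].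
have e20 : e / 2 != 0 by rewrite mulf_neq0 ?gt_eqF // invr_neq0.
exists [set v | V ((e / 2)^-1 *: v)].
  have c0 : (e / 2)^-1 *: v @[v --> (0 : X)] --> (0 : X).
    by rewrite -[X in _ --> X](scaler0 _ (e / 2)^-1); apply: cvgXZr; exact: cvg_id.
  exact: c0.
move=> c v c1 Vv; have := AV (c * (e / 2), (e / 2)^-1 *: v) => /=.
rewrite scalerA mulfK //; apply; split=> //=; apply: eA.
rewrite -ball_normE /= sub0r normrN normrM.
have e2e : `|e / 2| < e by rewrite gtr0_norm ?divr_gt0 // ltr_pdivrMr // ltr_pMr // ltr1n.
by apply: le_lt_trans e2e; rewrite ler_piMl.
Qed.
End TopologicalModule.

(** * Polynomials in an operator and dense orbits *)

Section Orbit.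
Variables (R : realType) (X : topologicalLmodType R[i]) (T : {linear X -> X}).
Hypothesis T_cont : continuous T.
Implicit Types (u v x : X) (p q : {poly R[i]}) (lam c : R[i]) (s t : R).

(** The general linearity lemmas also match the scaling operators that occur
next to [T]; these instances only match [T]. *)
Lemma opZ c u : T (c *: u) = c *: T u.
Proof. by rewrite linearZ. Qed.

Lemma opB u v : T (u - v) = T u - T v.
Proof. by rewrite linearB. Qed.

Lemma iter_continuous n : continuous (iter n T).
Proof.
elim: n => [|n IHn] u; first exact: cvg_id.
by apply: (@continuous_comp _ _ _ (iter n T) T); [exact: IHn|exact: T_cont].
Qed.

Lemma iter_linear n c u v :
  iter n T (c *: u + v) = c *: iter n T u + iter n T v.
Proof. by elim: n => //= n ->; rewrite linearP. Qed.

Lemma iterTD n u v : iter n T (u + v) = iter n T u + iter n T v.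
Proof. by have := iter_linear n 1 u v; rewrite !scale1r. Qed.

Lemma iterTZ n c u : iter n T (c *: u) = c *: iter n T u.
Proof. by elim: n => //= n ->; rewrite linearZ. Qed.

Lemma iterTB n u v : iter n T (u - v) = iter n T u - iter n T v.
Proof. by rewrite iterTD -scaleN1r iterTZ scaleN1r. Qed.

Definition poly_action p u : X := \sum_(i < size p) p`_i *: iter i T u.

Lemma poly_actionE n p u : (size p <= n)%N ->
  poly_action p u = \sum_(i < n) p`_i *: iter i T u.
Proof.
move=> pn; rewrite /poly_action (big_ord_widen n (fun i => p`_i *: iter i T u)) //.
rewrite big_mkcond /=; apply: eq_bigr => i _; case: ltnP => // pi.
by rewrite nth_default // scale0r.
Qed.

Lemma poly_actionDl p q u : poly_action (p + q) u = poly_action p u + poly_action q u.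
Proof.
pose n := maxn (size p) (size q).
rewrite !(@poly_actionE n) ?leq_maxl ?leq_maxr ?size_polyD // -big_split /=.
by apply: eq_bigr => i _; rewrite coefD scalerDl.
Qed.

Lemma poly_actionZl c p u : poly_action (c *: p) u = c *: poly_action p u.
Proof.
rewrite !(@poly_actionE (size p)) ?size_scale_leq // scaler_sumr.
by apply: eq_bigr => i _; rewrite coefZ scalerA.
Qed.

Lemma poly_actionC c u : poly_action c%:P u = c *: u.
Proof. by rewrite (@poly_actionE 1) ?size_polyC_leq1 // big_ord1 coefC. Qed.

Lemma poly_actionMX p u : poly_action (p * 'X) u = T (poly_action p u).
Proof.
rewrite (@poly_actionE (size p).+1) ?(leq_trans (size_polyMleq _ _)) //;
  last by rewrite size_polyX addn2.
rewrite big_ord_recl coefMX /= scale0r add0r /poly_action linear_sum.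
by apply: eq_bigr => i _; rewrite coefMX /= linearZ.
Qed.

Lemma poly_actionX u : poly_action 'X u = T u.
Proof. by rewrite -['X]mul1r poly_actionMX poly_actionC scale1r. Qed.

Lemma poly_actionM p q u : poly_action (p * q) u = poly_action p (poly_action q u).
Proof.
elim/poly_ind: p => [|p c IHp]; first by rewrite mul0r -[0]/(0%:P) !poly_actionC !scale0r.
rewrite mulrDl poly_actionDl [in RHS]poly_actionDl poly_actionC mul_polyC poly_actionZl.
by rewrite mulrAC !poly_actionMX IHp.
Qed.

Lemma poly_actionT p u : poly_action p (T u) = T (poly_action p u).
Proof. by rewrite -poly_actionMX poly_actionM poly_actionX. Qed.

Lemma poly_action_iter p n u : poly_action p (iter n T u) = iter n T (poly_action p u).
Proof. by elim: n => //= n IHn; rewrite poly_actionT IHn. Qed.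

Lemma poly_actionXn n u : poly_action 'X^n u = iter n T u.
Proof.
elim: n => [|n IHn]; first by rewrite expr0 poly_actionC scale1r.
by rewrite exprSr poly_actionMX IHn.
Qed.

Lemma poly_action_continuous p : continuous (poly_action p).
Proof.
apply: continuous_big; first exact: add_continuous.
by move=> i _ u; apply: cvgXZr; exact: iter_continuous.
Qed.

Definition orbit_dense x := forall v U, nbhs v U -> exists n, U (iter n T x).

Definition rotated_dense x :=
  forall v U, nbhs v U -> exists n s, U (cis s *: iter n T x).

(** [x] belongs to the closure of [L := range (T - lam)].  Modulo [L] the
operator is multiplication by [lam], so the vectors [cis s *: lam ^+ n *: x]
come close to every vector of the quotient.  If [1 <= `|lam|] they come close
to 0 only if [x] does.  If [`|lam| < 1] they come close to [2 x] only if [x] is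
close to 0, as the coefficient of [x] in the difference has modulus at least
1. *)
Lemma range_sub_approx x lam W : rotated_dense x -> nbhs 0 W ->
  exists y w, W w /\ x = (T y - lam *: y) + w.
Proof.
move=> dx /nbhs0_disk[V V0 VW].
pose L := [set l | exists y, l = T y - lam *: y].
have LZ c l : L l -> L (c *: l).
  move=> [y ->]; exists (c *: y); rewrite opZ scalerBr !scalerA.
  by rewrite [c * _]mulrC.
have LD l l' : L l -> L l' -> L (l + l').
  by move=> [y ->] [z ->]; exists (y + z); rewrite linearD scalerDr opprD addrACA.
have LT l : L l -> L (T l).
  by move=> [y ->]; exists (T y); rewrite opB opZ.
have Liter n : L (iter n T x - lam ^+ n *: x).
  elim: n => [|n IHn].
    by exists 0; rewrite expr0 scale1r subrr linear0 scaler0 subrr.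
  have -> : iter n.+1 T x - lam ^+ n.+1 *: x =
      T (iter n T x - lam ^+ n *: x) + lam ^+ n *: (T x - lam *: x).
    by rewrite opB opZ scalerBr scalerA -exprSr addrA subrK.
  by have := LD _ _ (LT _ IHn) (LZ (lam ^+ n) (T x - lam *: x) (ex_intro _ x erefl)).
suff [c [w [l [c1 Vw Ll ->]]]] : exists c w l,
    [/\ `|c| <= 1, V w, L l & x = l + c *: w].
  have [y ->] := Ll; exists y, (c *: w); split=> //; exact: VW.
have [lam1|lam1] := real_leP (@real1 _) (normr_real lam).
  have [n [s Vns]] := dx 0 V V0.
  have lamn0 : lam ^+ n != 0.
    rewrite expf_neq0 // -normr_gt0; exact: lt_le_trans lam1.
  exists (lam ^- n * cis (- s)), (cis s *: iter n T x),
    (- lam ^- n *: (iter n T x - lam ^+ n *: x)); split=> //.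
  - rewrite normrM normc_cis mulr1 normfV normrX invf_le1 ?exprn_ege1 //.
    by rewrite exprn_gt0 // (lt_le_trans _ lam1).
  - exact: LZ.
  - rewrite scalerA -mulrA cisN_mul mulr1 scalerBr scalerA mulNr mulVf //.
    by rewrite !scaleNr scale1r opprK addrAC addNr add0r.
have V2x : nbhs (x *+ 2) [set v | V (v - x *+ 2)].
  have c0 : v - x *+ 2 @[v --> x *+ 2] --> (0 : X).
    rewrite -[X in _ --> X](subrr (x *+ 2)).
    by apply: cvgXD; [exact: cvg_id|exact: cvg_cst].
  exact: c0.
have [n [s /= Vns]] := dx _ _ V2x.
set w := _ - _ in Vns.
pose a := cis s * lam ^+ n - 2.
have a1 : 1 <= `|a|.
  have := lerB_dist 2 (cis s * lam ^+ n).
  rewrite distrC normrM normc_cis mul1r normrX normr_nat; apply: le_trans.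
  have h : `|lam| ^+ n <= 1 by rewrite exprn_ile1 // ltW.
  by rewrite -[2]/(1 + 1) -addrA lerDl subr_ge0.
have a0 : a != 0 by rewrite -normr_gt0; exact: lt_le_trans a1.
exists a^-1, w, ((- a^-1 * cis s) *: (iter n T x - lam ^+ n *: x)); split=> //.
- by rewrite normfV invf_le1 // (lt_le_trans _ a1).
- exact: LZ.
- have ax : a *: x = w - cis s *: (iter n T x - lam ^+ n *: x).
    rewrite /a /w scalerBl scalerBr scalerA opprB [in RHS]addrC addrA subrK.
    by rewrite scaler_nat.
  rewrite mulNr scaleNr -scalerA addrC -scalerBr -ax scalerA mulVf //.
  by rewrite scale1r.
Qed.

(** The closure of the range of [T - lam] is invariant under [T] and scalars,
so with [x] it contains the rotated orbit of [x]. *)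
Lemma range_sub_dense x lam v U : rotated_dense x -> nbhs v U ->
  exists y, U (T y - lam *: y).
Proof.
move=> dx vU.
have [V [Vo Vv VU]] : exists V, [/\ open V, V v & V `<=` U].
  by move: vU; rewrite nbhsE => -[V [Vo Vv] VU]; exists V.
have [n [s Vns]] := dx v V (open_nbhs_nbhs (conj Vo Vv)).
pose f z := cis s *: iter n T (x - z).
have cf : f z @[z --> (0 : X)] --> f 0.
  apply: cvgXZr; apply: (@continuous_comp _ _ _ (fun z => x - z) (iter n T)).
    apply: cvgXD; first exact: cvg_cst.
    exact: (@opp_continuous X).
  exact: iter_continuous.
have fV : nbhs 0 [set z | V (f z)].
  by apply: cf; apply: open_nbhs_nbhs; split=> //; rewrite /f subr0.
have [y [w [Vw xE]]] := range_sub_approx lam dx fV.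
exists (cis s *: iter n T y); apply: VU; move: Vw; rewrite /= /f.
rewrite {1}xE addrK iterTB iterTZ opZ -iterSr /= scalerBr.
by rewrite !scalerA [lam * _]mulrC.
Qed.

Lemma rotated_dense_factor x lam :
  rotated_dense x -> rotated_dense (T x - lam *: x).
Proof.
move=> dx v U vU.
have [V [Vo Vv VU]] : exists V, [/\ open V, V v & V `<=` U].
  by move: vU; rewrite nbhsE => -[V [Vo Vv] VU]; exists V.
have [y Vy] := range_sub_dense lam dx (open_nbhs_nbhs (conj Vo Vv)).
have cf : (T z - lam *: z) @[z --> y] --> T y - lam *: y.
  apply: cvgXD; first exact: T_cont.
  by rewrite -scaleNr; under eq_cvg do rewrite -scaleNr; apply: cvgXZr; exact: cvg_id.
have [n [s h]] := dx y _ (cf _ (open_nbhs_nbhs (conj Vo Vy))).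
exists n, s; apply: VU; move: h; rewrite /= iterTB iterTZ opZ -iterSr /=.
by rewrite scalerBr !scalerA [lam * _]mulrC.
Qed.

Lemma rotated_dense_scale x c : c != 0 ->
  rotated_dense x -> rotated_dense (c *: x).
Proof.
move=> c0 dx v U vU.
have cf : c *: z @[z --> c^-1 *: v] --> v.
  rewrite -[X in _ --> X]scale1r -(divff c0) -scalerA.
  by apply: cvgXZr; exact: cvg_id.
have [n [s h]] := dx _ _ (cf _ vU); exists n, s.
by move: h; rewrite /= iterTZ !scalerA [c * _]mulrC.
Qed.

(** [p] splits into linear factors over the complex numbers. *)
Lemma rotated_dense_poly x p : p != 0 ->
  rotated_dense x -> rotated_dense (poly_action p x).
Proof.
move=> p0 dx; have [r pE] := closed_field_poly_normal p.
rewrite pE poly_actionZl; apply: rotated_dense_scale; first by rewrite lead_coef_eq0.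
elim: r {pE} => [|lam r IHr]; first by rewrite big_nil poly_actionC scale1r.
rewrite big_cons poly_actionM poly_actionDl poly_actionX -polyCN poly_actionC scaleNr.
exact: rotated_dense_factor.
Qed.
End Orbit.

(** * Winding of angle-valued functions on cyclic vectors *)

Section Turning.
Variables (R : realType) (X : topologicalLmodType R[i]).
Variables (H : set X) (r : X -> R).
Hypothesis r_cont : forall q, H q -> forall e, 0 < e ->
  \forall q' \near q, H q' -> ang (r q' - r q) < e.
Variable x : X.
Implicit Types (q : X) (t e : R).

Definition clamp t : R := Num.max 0 (Num.min 1 t).

Lemma clamp_id t : 0 <= t <= 1 -> clamp t = t.
Proof. by move=> /andP[t0 t1]; rewrite /clamp min_r // max_r. Qed.

Lemma clamp_continuous : continuous clamp.
Proof.
move=> t; apply: (@continuous_max _ _ (cst _) (fun t => Num.min 1 t)).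
  exact: cvg_cst.
by apply: (@continuous_min _ _ (cst _) id); [exact: cvg_cst|exact: cvg_id].
Qed.

Definition segment q t : X := x + (clamp t)%:C%C *: (q - x).

Lemma segment_near q t U : nbhs (segment q t) U ->
  \forall t' \near t & q' \near q, U (segment q' t').
Proof.
have : segment z.2 z.1 @[z --> (t, q)] --> segment q t.
  apply: cvgXD; first exact: cvg_cst.
  apply: cvgXZ.
    apply: (@cvg_complex R _ _ _ (fun z : R * X => clamp z.1) (cst 0));
      last exact: cvg_cst.
    apply: (@cvg_comp _ _ _ fst clamp _ (nbhs t)); last exact: clamp_continuous.
    exact: (@cvg_fst _ _ (nbhs t) (nbhs q)).
  by apply: cvgXD; [exact: cvg_snd|exact: cvg_cst].
move=> /[apply] -[[A B] [/= At Bq] AB].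
by apply: (near2I At Bq) => t' q' At' Bq'; exact: (AB (t', q')).
Qed.

Definition visible q := forall t, H (segment q t).

(** The continuous real lift of [r q - r x], obtained along the segment from [x]
to [q]. *)
Definition swept q := turn (r \o segment q).

Lemma segment_ang_continuous q : visible q -> ang_continuous (r \o segment q).
Proof.
move=> vq t e e0; have [[A B] /= [At Bq] AB] := segment_near (r_cont (vq t) e0).
apply: filterS At => s As /=; apply: (AB (s, q)) => //=.
by split=> //; exact: nbhs_singleton.
Qed.

Lemma swept_cong q : visible q -> ang (swept q - (r q - r x)) = 0.
Proof.
move=> /segment_ang_continuous/turn_cong; rewrite -/(swept q) /= /segment.
rewrite !clamp_id ?lexx ?ler01 // scale1r scale0r addr0 [x + _]addrC subrK.
by [].
Qed.

Lemma swept_base : swept x = 0.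
Proof.
rewrite /swept (_ : _ \o _ = fun=> r x) ?turn_cst //.
by apply/funext => t; rewrite /= /segment subrr scaler0 addr0.
Qed.

(** Along the compact segment [r] changes little, uniformly, when the endpoint
moves. *)
Lemma swept_near q e : visible q -> 0 < e ->
  \forall q' \near q, visible q' -> `|swept q' - swept q| < e.
Proof.
move=> vq e0; have [d d0 hd] := @turn_close R e e0.
have d2 : 0 < d / 2 by rewrite divr_gt0.
have /compact_near_coveringP cov := @segment_compact R 0 1.
pose P q' t := H (segment q' t) -> ang (r (segment q' t) - r (segment q t)) < d.
have hP t : `[0, 1]%classic t -> \forall t' \near t & q' \near q, P q' t'.
  move=> _; have [[A B] /= [At Bq] AB] := segment_near (r_cont (vq t) d2).
  apply: (near2I At Bq) => s q' As Bq' Hs.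
  have h1 := AB (s, q') (conj As Bq') Hs.
  have h2 := AB (s, q) (conj As (nbhs_singleton Bq)) (vq s).
  have := ang_triangle (r (segment q t)) (r (segment q' s)) (r (segment q s)).
  rewrite (angB (r (segment q t))) => h; apply: (le_lt_trans h).
  by rewrite /= in h1 h2; lra.
have : \forall q' \near q, `[0, 1]%classic `<=` P q' by exact: cov hP.
apply: filterS => q' hq' vq'; apply: hd; try exact: segment_ang_continuous.
by move=> t t01; apply: hq' => //=; rewrite in_itv.
Qed.

Lemma swept_path (g : R -> X) : continuous g -> (forall t, visible (g t)) ->
  continuous (swept \o g).
Proof.
move=> cg vg t; apply/cvgrPdist_lt => e e0.
have : \forall s \near t, visible (g s) -> `|swept (g s) - swept (g t)| < e.
  exact: cg t _ (swept_near (vg t) e0).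
by apply: filterS => s /(_ (vg s)); rewrite distrC.
Qed.
End Turning.

Section Eigenphase.
Variables (R : realType) (X : topologicalLmodType R[i]) (T : {linear X -> X}).
Hypothesis T_cont : continuous T.
Variables (x : X) (r : X -> R).
Implicit Types (p q : {poly R[i]}).

Definition cyclic : set X := [set u | exists2 p, p != 0 & u = poly_action T p x].

Hypothesis r_cont : forall v, cyclic v -> forall e, 0 < e ->
  \forall v' \near v, cyclic v' -> ang (r v' - r v) < e.

Lemma cyclicM p u : p != 0 -> cyclic u -> cyclic (poly_action T p u).
Proof.
by move=> p0 [q q0 ->]; exists (p * q); [rewrite mulf_neq0|rewrite poly_actionM].
Qed.

Lemma cyclic_base : cyclic x.
Proof. by exists 1; [exact: oner_neq0|rewrite poly_actionC scale1r]. Qed.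

(** The points of the segment are [((1 - t) + t q)(T) x], and the polynomials
[(1 - t) + t q] all take the value 1 at [z], hence are nonzero. *)
Lemma visible_poly q z : q.[z] = 1 -> visible cyclic x (poly_action T q x).
Proof.
move=> qz t; rewrite /segment; set c := (clamp t)%:C%C.
exists ((1 - c)%:P + c *: q).
  apply/eqP => /(congr1 (fun p => p.[z])).
  by rewrite hornerD hornerZ hornerC horner0 qz mulr1 subrK => /eqP; rewrite oner_eq0.
rewrite poly_actionDl poly_actionZl poly_actionC scalerBr scalerBl scale1r.
by rewrite addrA addrAC.
Qed.

(** The lift [G] of [r] satisfies [G (T u) - G u = b] for a single real number
[b] along the polygon [x, T x, T^2 x, ...], since the difference is continuous
and congruent to [mu].  So [G (T^n x) = n b], while [G] is small near [x]. *)
Lemma return_eigenphase mu :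
  (forall u, cyclic u -> ang (r (T u) - r u - mu) = 0) ->
  (forall U, nbhs x U -> exists2 n, (0 < n)%N & U (iter n T x)) ->
  ang mu = 0.
Proof.
move=> rT ret; set G := swept r x.
pose y n t : X := iter n T x + (clamp t)%:C%C *: (iter n.+1 T x - iter n T x).
pose Y (n : nat) (t : R) : {poly R[i]} := 'X^n + (clamp t)%:C%C *: ('X^(n.+1) - 'X^n).
have yE n t : y n t = poly_action T (Y n t) x.
  rewrite /y /Y -[- 'X^n]scaleN1r poly_actionDl poly_actionZl poly_actionDl.
  by rewrite poly_actionZl !poly_actionXn scaleN1r.
(* A convex combination of powers of the indeterminate takes the value 1 at 1,
   so the whole polygon is visible from x. *)
have Y1 n t : (Y n t).[1] = 1.
  by rewrite /Y !hornerE !expr1n subrr mulr0 addr0.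
have vy n t : visible cyclic x (y n t) by rewrite yE; exact: visible_poly (Y1 n t).
have cy n t : cyclic (y n t).
  rewrite yE; exists (Y n t) => //; apply/eqP => Y0.
  by have /eqP := Y1 n t; rewrite Y0 horner0 eq_sym oner_eq0.
have Ty n t : T (y n t) = y n.+1 t.
  by rewrite /y linearD opZ opB.
have cty n : continuous (y n).
  move=> t; apply: cvgXD; first exact: cvg_cst.
  apply: cvgXZ; last exact: cvg_cst.
  apply: (@cvg_complex R _ _ _ (@clamp R) (cst 0)); last exact: cvg_cst.
  exact: clamp_continuous.
have y0 n : y n 0 = iter n T x.
  by rewrite /y clamp_id ?lexx ?ler01 // scale0r addr0.
have y1 n : y n 1 = iter n.+1 T x.
  by rewrite /y clamp_id ?lexx ?ler01 // scale1r addrC subrK.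
pose D n t := G (y n.+1 t) - G (y n t).
have cD n : continuous (D n).
  by move=> t; apply: cvgB; exact: (swept_path r_cont (cty _) (vy _)).
have Dmu n t : ang (D n t - mu) = 0.
  have h1 := swept_cong r_cont (vy n.+1 t).
  have h2 := swept_cong r_cont (vy n t).
  have h3 := rT _ (cy n t); rewrite Ty in h3.
  apply: etrans (ang_eq0D (ang_eq0B h1 h2) h3).
  by congr ang; rewrite /D /G; ring.
have Dcst n : D n 1 = D n 0.
  apply: ang_locally_constant => [|t _]; first exact: cD.
  apply: etrans (ang_eq0B (Dmu n t) (Dmu n 0)).
  by congr ang; ring.
set b := G (T x).
have G0 : G x = 0 by exact: swept_base.
have DE n : D n 0 = b.
  elim: n => [|n IHn]; first by rewrite /D !y0 /= G0 subr0.
  by rewrite -IHn -(Dcst n) /D !y0 !y1.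
have Gn n : G (iter n T x) = n%:R * b.
  elim: n => [|n IHn]; first by rewrite mul0r.
  by have := DE n; rewrite /D !y0 IHn -natr1 => /eqP; rewrite subr_eq => /eqP ->; ring.
have b0 : b = 0.
  apply/eqP; rewrite -normr_le0; apply/ler_addgt0Pl => e e0; rewrite addr0.
  have vx : visible cyclic x x by have := vy 0%N 0; rewrite y0.
  have [n n0 /=] := ret _ (swept_near r_cont vx e0).
  have vn : visible cyclic x (iter n T x) by have := vy n 0; rewrite y0.
  move=> /(_ vn); rewrite swept_base subr0 -/G Gn normrM normr_nat => h.
  apply: le_trans (ltW h); rewrite ler_peMl //.
  by rewrite ler1n.
by have := Dmu 0%N 0; rewrite DE b0 sub0r angN.
Qed.

(** The loop [cis s *: T x], for [s] between 0 and 2 pi, lies in the visible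
domain; the simpler loop [cis s *: x] would not do, as the segment from [x] to
[- x] meets 0.  Along the loop the lift of [r] plus [k s] is continuous with
constant residue, hence constant. *)
Lemma rotation_degree (k : R) :
  (forall u s, cyclic u -> ang (r (cis s *: u) - r u + k * s) = 0) -> k = 0.
Proof.
move=> rk; set G := swept r x.
pose y t := cis (t * (pi *+ 2)) *: T x.
have yE t : y t = poly_action T (cis (t * (pi *+ 2)) *: 'X) x.
  by rewrite poly_actionZl poly_actionX.
have vy t : visible cyclic x (y t).
  rewrite yE; apply: (@visible_poly _ (cis (- (t * (pi *+ 2))))).
  by rewrite !hornerE mulrC cisN_mul.
have cTx : cyclic (T x) by exists 'X; [by rewrite polyX_eq0|rewrite poly_actionX].
have cty : continuous y.
  move=> t; apply: cvgXZ; last exact: cvg_cst.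
  apply: (@continuous_comp R R R[i]^o (fun t => t * (pi *+ 2)) (@cis R)).
    by apply: cvgMl; exact: cvg_id.
  exact: cis_continuous.
pose D t := G (y t) + k * (t * (pi *+ 2)).
have : D 1 = D 0.
  have DTx t : ang (D t - (r (T x) - r x)) = 0.
    apply: etrans (ang_eq0D (swept_cong r_cont (vy t)) (rk _ (t * (pi *+ 2)) cTx)).
    by congr ang; rewrite /D /G /y; ring.
  apply: ang_locally_constant => [t|t _].
    apply: cvgD; first exact: (swept_path r_cont cty vy).
    by apply: cvgMr; apply: cvgMl; exact: cvg_id.
  apply: etrans (ang_eq0B (DTx t) (DTx 0)).
  by congr ang; ring.
rewrite /D mul1r mul0r mulr0 addr0.
have -> : y 1 = y 0.
  rewrite /y; congr (_ *: _); apply: cis_ang.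
  by rewrite mul1r mul0r subr0 ang_2pi.
move=> /eqP; rewrite -subr_eq0 addrAC subrr add0r mulf_eq0 => /orP[/eqP //|].
by rewrite gt_eqF // pi2_gt0.
Qed.
End Eigenphase.

(** * Orbits dense up to rotations *)

Lemma ang_near_rep (R : realType) (t : R) (P : set R) : nbhs t P ->
  exists2 e, 0 < e & forall s, ang (s - t) < e ->
    exists2 s', ang (s' - s) = 0 & P s'.
Proof.
move=> /nbhs_ballP[d /= d0 dP]; have [e e0 he] := princ_small d0.
exists (Num.min e 4^-1); first by rewrite lt_min e0 invr_gt0 /=.
move=> s; rewrite lt_min => /andP[/he se /princ_cong st].
exists (t + princ (s - t)); first by apply: etrans st; congr ang; ring.
by apply: dP; rewrite -ball_normE /= opprD addrA subrr sub0r normrN.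
Qed.

Section Unrotate.
Variables (R : realType) (X : topologicalLmodType R[i]) (T : {linear X -> X}).
Hypothesis T_cont : continuous T.
Implicit Types (u v x : X) (s t : R).

Lemma rotate_near s v U : nbhs (cis s *: v) U ->
  \forall s' \near s & v' \near v, U (cis s' *: v').
Proof.
have : cis z.1 *: z.2 @[z --> (s, v)] --> cis s *: v.
  apply: cvgXZ; last exact: (@cvg_snd _ _ (nbhs s) (nbhs v)).
  apply: (@cvg_comp _ _ _ fst (@cis R : R -> R[i]^o) _ (nbhs s)).
    exact: (@cvg_fst _ _ (nbhs s) (nbhs v)).
  exact: cis_continuous.
move=> /[apply] -[[A B] [/= At Bq] AB].
by apply: (near2I At Bq) => t' q' At' Bq'; exact: (AB (t', q')).
Qed.

Definition reaches u s v := forall U, nbhs (cis s *: v) U ->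
  exists n, U (iter n T u).

Lemma reaches_ang u s t v : ang (s - t) = 0 -> reaches u s v -> reaches u t v.
Proof. by move=> /cis_ang st; rewrite /reaches st. Qed.

Lemma not_reaches u t v : ~ reaches u t v -> exists2 e, 0 < e &
  \forall v' \near v, forall s, ang (s - t) < e -> ~ reaches u s v'.
Proof.
move=> /existsNP[U0] /not_implyP[]; rewrite nbhsE => -[U [Uo Uv] UU0] nU.
have [[A B] /= [At Bv] AB] := rotate_near (open_nbhs_nbhs (conj Uo Uv)).
have [e e0 he] := ang_near_rep At; exists e => //.
apply: filterS Bv => v' Bv' s /he[s' ss' As'] /(@reaches_ang _ _ s').
rewrite angB => /(_ ss') us'; apply: nU.
have [n Un] := us' _ (open_nbhs_nbhs (conj Uo (AB (s', v') (conj As' Bv')))).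
by exists n; exact: UU0.
Qed.

Lemma reaches_closed u t v :
  (forall e, 0 < e -> exists2 s, reaches u s v & ang (s - t) < e) ->
  reaches u t v.
Proof.
move=> h; apply: contrapT => /not_reaches[e e0 /nbhs_singleton he].
by have [s us st] := h e e0; exact: (he s st us).
Qed.

Lemma reaches_refl u : reaches u 0 u.
Proof. by move=> U; rewrite cis0 scale1r => /nbhs_singleton; exists 0%N. Qed.

Lemma reaches_trans u s v t w : reaches u s v -> reaches v t w ->
  reaches u (s + t) w.
Proof.
move=> us vt U0; rewrite nbhsE => -[U [Uo Uw] UU0].
have c1 : (cis s *: z) @[z --> cis t *: w] --> cis (s + t) *: w.
  by rewrite cisD -scalerA; apply: cvgXZr; exact: cvg_id.
have [m Um] := vt _ (c1 _ (open_nbhs_nbhs (conj Uo Uw))).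
have c2 : iter m T z @[z --> cis s *: v] --> cis s *: iter m T v.
  by rewrite -iterTZ; exact: iter_continuous.
have [n Un] := us _ (c2 _ (open_nbhs_nbhs (conj Uo Um))).
by exists (m + n)%N; apply: UU0; rewrite iterD.
Qed.

(** Otherwise, by compactness of the circle, a whole neighbourhood of [v] would
miss all rotations of the orbit of [u]. *)
Lemma reaches_some u v : rotated_dense T u -> exists t, reaches u t v.
Proof.
move=> du; apply: contrapT => /forallNP nuv.
have /compact_near_coveringP cov := @segment_compact R 0 (pi *+ 2).
pose P v' t := forall n, cis t *: v' <> iter n T u.
have hP t : `[0, pi *+ 2]%classic t -> \forall t' \near t & v' \near v, P v' t'.
  move=> _; have [e e0 he] := not_reaches (nuv t).
  apply: (near2I (ang_near t e0) he) => s v' /= st /(_ s st) nr n E.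
  by apply: nr => U; rewrite E => /nbhs_singleton; exists n.
have : \forall v' \near v, `[0, pi *+ 2]%classic `<=` P v' by exact: cov hP.
move=> /du[n [s /= h]]; have [t ts t02] := ang_reduce (- s).
apply: (h t _ n); first by rewrite /= in_itv.
by rewrite (cis_ang ts) scalerA cisN_mul scale1r.
Qed.

Lemma cyclic_rotated_dense x u : rotated_dense T x -> cyclic T x u ->
  rotated_dense T u.
Proof. by move=> dx [p p0 ->]; exact: rotated_dense_poly. Qed.

(** If only the [k]-th roots of unity can be reached from [x] in its own fibre,
the cocycle satisfies [r (cis a *: u) = r u - k a], against the degree
computation. *)
Lemma rotated_dense_orbit_dense x : rotated_dense T x -> orbit_dense T x.
Proof.
move=> dx.
have Acl p t q : cyclic T x p -> cyclic T x q ->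
  (forall e, 0 < e -> exists2 s, reaches p s q & ang (s - t) < e) ->
  reaches p t q by move=> _ _; exact: reaches_closed.
have A0 p : cyclic T x p -> reaches p 0 p by move=> _; exact: reaches_refl.
have AD p s q t w : cyclic T x p -> cyclic T x q -> cyclic T x w ->
  reaches p s q -> reaches q t w -> reaches p (s + t) w.
  by move=> _ _ _; exact: reaches_trans.
have Aex p q : cyclic T x p -> cyclic T x q -> exists t, reaches p t q.
  by move=> /(cyclic_rotated_dense dx) dp _; exact: reaches_some.
have cx := cyclic_base T x.
have [all|[k k0 [F FP]]] := circle_cocycle Acl A0 AD Aex.
  move=> v U0; rewrite nbhsE => -[U [Uo Uv] UU0].
  have [n [s Us]] := dx v U (open_nbhs_nbhs (conj Uo Uv)).
  have cn : cyclic T x (iter n T x).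
    by exists 'X^n; [rewrite expf_neq0 // polyX_eq0|rewrite poly_actionXn].
  have [m Um] := all x s _ cx cn _ (open_nbhs_nbhs (conj Uo Us)).
  by exists m; exact: UU0.
have k_eq0 : k%:R = 0 :> R.
  apply: (@rotation_degree _ _ T x (F x)) => [v cv|u a cu].
    apply: (cocycle_near k0 FP cx cv) => t.
    exact: not_reaches.
  have cau : cyclic T x (cis a *: u).
    rewrite -(poly_actionC T); apply: cyclicM cu.
    rewrite polyC_eq0 -normr_eq0 normc_cis; exact: oner_neq0.
  have [t At tE] := cocycle_attained k0 FP cx cau.
  have /(FP _ _ _ cx cu) tE' : reaches x (t + a) u.
    by move=> U; rewrite cisD -scalerA; exact: At.
  apply: etrans (ang_eq0B tE' tE).
  by congr ang; ring.
by move: k_eq0 => /eqP; rewrite pnatr_eq0 eqn0Ngt k0.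
Qed.
End Unrotate.

(** * The skew product with the differences of the phase *)

Section PhaseState.
Variable R : realType.
Implicit Types (th ph : nat -> R) (m n i : nat) (t e : R).

(** The effect of one step of time on the sequence of finite differences of a
function: Newton's rule. *)
Definition shift th : nat -> R := fun i => th i + th i.+1.

Definition set_coord m t th : nat -> R := fun i => if i == m then t else th i.

Definition phase_close m e th ph := forall i, (m <= i)%N -> ang (th i - ph i) < e.

Definition vanishing D th := forall i, (D <= i)%N -> th i = 0.

Lemma vanishing_shift D th : vanishing D th -> vanishing D (shift th).
Proof. by move=> h i Di; rewrite /shift !h ?addr0 // (leq_trans Di). Qed.

Lemma vanishing_iter D n th : vanishing D th -> vanishing D (iter n shift th).
Proof. by move=> h; elim: n => //= n; exact: vanishing_shift. Qed.

Lemma iter_shift_ext m n th ph : (forall i, (m <= i)%N -> th i = ph i) ->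
  forall i, (m <= i)%N -> iter n shift th i = iter n shift ph i.
Proof.
move=> h; elim: n => [//|n IHn] i mi /=.
by rewrite /shift !IHn // (leq_trans mi).
Qed.

(** Coordinates above [m] never see coordinate [m], so on coordinates at least
[m] a rotation of coordinate [m] commutes with the dynamics. *)
Lemma iter_shift_set_coord m n s t th i : (m <= i)%N ->
  iter n shift (set_coord m (s + t) th) i =
  iter n shift (set_coord m s th) i + (if i == m then t else 0).
Proof.
elim: n i => [|n IHn] i mi /=.
  by rewrite /set_coord; case: ifP => // _; rewrite addr0.
rewrite /shift !IHn ?(leq_trans mi) // [i.+1 == m]gtn_eqF ?ltnS // addr0.
by rewrite addrAC.
Qed.

Lemma phase_close_shift m e th ph :
  phase_close m (e / 2) th ph -> phase_close m e (shift th) (shift ph).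
Proof.
move=> h i mi; have h1 := h i mi; have h2 := h i.+1 (leq_trans mi (leqnSn i)).
have := ang_le_add (th i - ph i) (th i.+1 - ph i.+1).
have -> : th i - ph i + (th i.+1 - ph i.+1) = shift th i - shift ph i.
  by rewrite /shift; ring.
by move=> h3; apply: (le_lt_trans h3); lra.
Qed.

Lemma phase_close_iter m n e : 0 < e -> exists2 d, 0 < d &
  forall th ph, phase_close m d th ph ->
    phase_close m e (iter n shift th) (iter n shift ph).
Proof.
elim: n e => [|n IHn] e e0; first by exists e.
have [d d0 hd] := IHn (e / 2) (ltac:(by rewrite divr_gt0)).
by exists d => // th ph /hd; exact: phase_close_shift.
Qed.

Lemma phase_close_trans m e e' th ps ph :
  phase_close m e th ps -> phase_close m e' ps ph -> phase_close m (e + e') th ph.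
Proof.
move=> h h' i mi; apply: (le_lt_trans (ang_triangle (ps i) _ _)).
by apply: ltrD; [exact: h|exact: h'].
Qed.
End PhaseState.

Section Skew.
Variables (R : realType) (X : topologicalLmodType R[i]) (T : {linear X -> X}).
Hypothesis T_cont : continuous T.
Implicit Types (u v w x : X) (th ph ps : nat -> R) (s t e : R) (m n i : nat).

(** [(v, ph)] lies in the closure of the forward orbit of [(u, th)], where
phases are compared modulo 2 pi and on coordinates at least [m] only. *)
Definition arrow m u th v ph := forall U e, nbhs v U -> 0 < e ->
  exists n, U (iter n T u) /\ phase_close m e (iter n (@shift R) th) ph.

Lemma arrow_refl m u th : arrow m u th u th.
Proof.
move=> U e /nbhs_singleton Uu e0; exists 0%N; split=> // i _.
by rewrite subrr ang0.
Qed.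

Lemma arrow_step m u th : arrow m u th (T u) (shift th).
Proof.
move=> U e /nbhs_singleton Uu e0; exists 1%N; split=> // i _.
by rewrite subrr ang0.
Qed.

Lemma arrow_trans m u th v ph w ps :
  arrow m u th v ph -> arrow m v ph w ps -> arrow m u th w ps.
Proof.
move=> uv vw U0 e + e0; rewrite nbhsE => -[U [Uo Uw] UU0].
have e2 : 0 < e / 2 by rewrite divr_gt0.
have [k [Uk kclose]] := vw _ _ (open_nbhs_nbhs (conj Uo Uw)) e2.
have [d d0 hd] := phase_close_iter m k e2.
have [n [Un nclose]] := uv _ d (iter_continuous T_cont (open_nbhs_nbhs (conj Uo Uk))) d0.
exists (k + n)%N; split; first by apply: UU0; rewrite iterD.
rewrite iterD [e]splitr; apply: phase_close_trans kclose.
exact: hd.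
Qed.

Lemma arrow_ext m u th th' v ph ph' :
  (forall i, (m <= i)%N -> th i = th' i) ->
  (forall i, (m <= i)%N -> ph i = ph' i) ->
  arrow m u th v ph -> arrow m u th' v ph'.
Proof.
move=> hth hph h U e vU e0; have [n [Un nclose]] := h U e vU e0.
exists n; split=> // i mi.
by rewrite -hph // -(iter_shift_ext n hth) //; exact: nclose.
Qed.

Lemma arrow_weaken m u th v ph : arrow m u th v ph -> arrow m.+1 u th v ph.
Proof.
move=> h U e vU e0; have [n [Un nclose]] := h U e vU e0.
by exists n; split=> // i mi; apply: nclose; exact: ltnW.
Qed.

Lemma arrow_shift m u th v ph :
  arrow m u th v ph -> arrow m (T u) (shift th) (T v) (shift ph).
Proof.
move=> h U e vU e0; have e2 : 0 < e / 2 by rewrite divr_gt0.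
have [n [Un nclose]] := h _ _ (T_cont vU) e2.
exists n; rewrite -!iterSr; split; first exact: Un.
exact: phase_close_shift.
Qed.

Lemma arrow_set_coord m u th v ph s s' t :
  arrow m u (set_coord m s th) v (set_coord m s' ph) ->
  arrow m u (set_coord m (s + t) th) v (set_coord m (s' + t) ph).
Proof.
move=> h U e vU e0; have [n [Un nclose]] := h U e vU e0.
exists n; split=> // i mi; rewrite iter_shift_set_coord //.
have := nclose i mi; rewrite /set_coord; case: eqP => // _; last by rewrite addr0.
by rewrite opprD addrACA subrr addr0.
Qed.

Definition state_nbhs m (z : X * (nat -> R)) : set_system (X * (nat -> R)) :=
  fun P => exists U e, [/\ nbhs z.1 U, 0 < e &
    forall q ph, U q -> phase_close m e ph z.2 -> P (q, ph)].

Global Instance state_nbhs_filter m z : Filter (state_nbhs m z).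
Proof.
split.
- by exists setT, 1; split=> //; exact: filterT.
- move=> P Q [U [e [Uz e0 hP]]] [V [d [Vz d0 hQ]]].
  exists (U `&` V), (Num.min e d); split; first exact: filterI.
    by rewrite lt_min e0.
  move=> q ph [Uq Vq] h; split.
    by apply: hP => // i /h; rewrite lt_min => /andP[].
  by apply: hQ => // i /h; rewrite lt_min => /andP[].
- move=> P Q PQ [U [e [Uz e0 hP]]]; exists U, e; split=> // q ph Uq /hP.
  by move=> /(_ _ Uq)/PQ.
Qed.

(** Coordinate [m] is reset before the rotation [t] is applied, so that the
states of the base are insensitive to their coordinate [m]. *)
Definition fiber_reaches m (z : X * (nat -> R)) t (z' : X * (nat -> R)) :=
  arrow m z.1 (set_coord m 0 z.2) z'.1 (set_coord m t z'.2).

Lemma fiber_reachesP m u th v ph :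
  arrow m u th v ph <-> fiber_reaches m (u, th) (ph m - th m) (v, ph).
Proof.
have setE ps i : set_coord m (ps m) ps i = ps i :> R.
  by rewrite /set_coord; case: eqP => // ->.
split=> [h|/(@arrow_set_coord _ _ _ _ _ _ _ (th m))] /=.
  have /(@arrow_set_coord _ _ _ _ _ _ _ (- th m)) :
      arrow m u (set_coord m (th m) th) v (set_coord m (ph m) ph).
    by apply: arrow_ext h => i _; rewrite setE.
  by rewrite subrr.
by rewrite add0r subrK; apply: arrow_ext => i _; rewrite setE.
Qed.

Lemma not_fiber_reaches m z t z' : ~ fiber_reaches m z t z' ->
  exists2 e, 0 < e & \forall y \near state_nbhs m.+1 z',
    forall s, ang (s - t) < e -> ~ fiber_reaches m z s y.
Proof.
move=> /existsNP[U0] /existsNP[e] /not_implyP[+] /not_implyP[e0].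
rewrite nbhsE => -[U [Uo Uz'] UU0] nU.
have e2 : 0 < e / 2 by rewrite divr_gt0.
exists (e / 2) => //; exists U, (e / 2); split=> //.
  exact: open_nbhs_nbhs.
move=> q ph Uq hph s st h; apply: nU.
have [n [Un nclose]] := h U (e / 2) (open_nbhs_nbhs (conj Uo Uq)) e2.
exists n; split; first exact: UU0.
rewrite [e]splitr; apply: phase_close_trans nclose _ => i mi.
rewrite /set_coord; case: eqP => // /eqP im; apply: hph.
by rewrite ltn_neqAle eq_sym im.
Qed.

Lemma fiber_reaches_closed m z t z' :
  (forall e, 0 < e -> exists2 s, fiber_reaches m z s z' & ang (s - t) < e) ->
  fiber_reaches m z t z'.
Proof.
move=> h; apply: contrapT => /not_fiber_reaches[e e0 [U [d [Uz d0 hU]]]].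
have [s zs st] := h e e0.
have := hU z'.1 z'.2 (nbhs_singleton Uz).
rewrite -surjective_pairing => /(_ _ s st zs); apply=> i _.
by rewrite subrr ang0.
Qed.

Lemma fiber_reaches_trans m z s z' t y : fiber_reaches m z s z' ->
  fiber_reaches m z' t y -> fiber_reaches m z (s + t) y.
Proof.
move=> h /(@arrow_set_coord _ _ _ _ _ _ _ s); rewrite add0r addrC.
exact: arrow_trans.
Qed.

(** One step of time changes the rotation by the difference of the coordinates
[m + 1]; it is unchanged between states with the same phase. *)
Lemma fiber_reaches_shift m p th t q ph :
  fiber_reaches m (p, th) t (q, ph) ->
  fiber_reaches m (T p, shift th) (t + ph m.+1 - th m.+1) (T q, shift ph).
Proof.
have E ps s i : (m <= i)%N ->
    shift (set_coord m s ps) i = set_coord m (s + ps m.+1) (shift ps) i :> R.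
  move=> mi; rewrite /shift /set_coord [i.+1 == m]gtn_eqF ?ltnS //.
  by case: eqP => // ->.
move=> /arrow_shift h.
have /(@arrow_set_coord _ _ _ _ _ _ _ (- th m.+1)) :
    arrow m (T p) (set_coord m (0 + th m.+1) (shift th))
      (T q) (set_coord m (t + ph m.+1) (shift ph)).
  by apply: arrow_ext h => i mi; rewrite E.
by rewrite add0r subrr.
Qed.

(** Reachability in the base lifts to the extension for some rotation, by
compactness of the circle. *)
Lemma fiber_reaches_some m p th q ph : arrow m.+1 p th q ph ->
  exists t, fiber_reaches m (p, th) t (q, ph).
Proof.
move=> h; apply: contrapT => /forallNP nfib.
have /compact_near_coveringP cov := @segment_compact R 0 (pi *+ 2).
pose th0 := set_coord m 0 th.
pose P (y : X * (nat -> R)) t := forall n, y.1 = iter n T p ->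
  (forall i, (m < i)%N -> y.2 i = iter n (@shift R) th0 i) ->
  ang (iter n (@shift R) th0 m - t) <> 0.
have hP t : `[0, pi *+ 2]%classic t ->
    \forall t' \near t & y \near state_nbhs m.+1 (q, ph), P y t'.
  move=> _; have [e e0 he] := not_fiber_reaches (nfib t).
  apply: (near2I (ang_near t e0) he) => s y /= st /(_ s st) nr n y1 y2 sm.
  apply: nr => U d /nbhs_singleton Uy d0; exists n; rewrite -y1; split=> // i mi.
  rewrite /set_coord; case: eqP => [->|/eqP im]; first by rewrite sm.
  by rewrite y2 ?subrr ?ang0 // ltn_neqAle eq_sym im.
have [U [e [Uq e0 hU]]] : \forall y \near state_nbhs m.+1 (q, ph),
  `[0, pi *+ 2]%classic `<=` P y by exact: cov hP.
have [n [Un nclose]] := h U e Uq e0.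
have E i : (m < i)%N -> iter n (@shift R) th i = iter n (@shift R) th0 i.
  by apply: iter_shift_ext => {}i mi; rewrite /th0 /set_coord gtn_eqF.
have [t ts t02] := ang_reduce (iter n (@shift R) th0 m).
apply: (hU _ _ Un nclose t _ n).
- by rewrite /= in_itv.
- by [].
- by move=> i /E.
- by rewrite angB.
Qed.
End Skew.

(** * Density of orbits with a polynomial phase *)

Section Tower.
Variables (R : realType) (X : topologicalLmodType R[i]) (T : {linear X -> X}).
Hypothesis T_cont : continuous T.
Variable x : X.
Hypothesis x_dense : rotated_dense T x.
Variable D : nat.
Implicit Types (p q u v w z : X) (th ph ps : nat -> R) (s t e : R) (m n i : nat).

Local Notation cyc := (cyclic T x).
Local Notation arrow := (arrow T).
Local Notation van := (vanishing D).
Local Notation sh := (@shift R).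

(** Reachability is symmetric in the phases and independent of the cyclic
vectors.  Both properties are packed in one implication, which applied twice
replaces [u] and [v] by arbitrary cyclic vectors. *)
Definition reversible m := forall th ph u v w z, van th -> van ph ->
  cyc u -> cyc v -> cyc w -> cyc z -> arrow m u th v ph -> arrow m z ph w th.

Lemma cyclic_orbit_dense u : cyc u -> orbit_dense T u.
Proof.
move=> cu; apply: (rotated_dense_orbit_dense T_cont).
exact: cyclic_rotated_dense cu.
Qed.

Lemma cyclicT u : cyc u -> cyc (T u).
Proof. by move=> cu; rewrite -poly_actionX; apply: cyclicM => //; rewrite polyX_eq0. Qed.

Lemma cyclic_iter n u : cyc u -> cyc (iter n T u).
Proof. by move=> cu; elim: n => //= n; exact: cyclicT. Qed.

Lemma reversible_top : reversible D.
Proof.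
move=> th ph u v w z vth vph _ _ _ cz _ U e wU e0.
have [n Un] := cyclic_orbit_dense cz wU.
exists n; split=> // i Di.
by rewrite (vanishing_iter n vph) // vth // subrr ang0.
Qed.

Section Step.
Variable m : nat.
Hypothesis rev : reversible m.+1.
Variable th : nat -> R.
Hypothesis van_th : van th.

(** The phases in the same minimal component as [th]. *)
Let C : set (nat -> R) := [set ph | van ph /\ arrow m.+1 x th x ph].
Let states : set (X * (nat -> R)) := [set y | cyc y.1 /\ C y.2].

Let st v ph : cyc v -> C ph -> states (v, ph).
Proof. by []. Qed.

Let cx : cyc x := cyclic_base T x.

Lemma arrow_all p ph q ps u v : van ph -> van ps -> cyc p -> cyc q -> cyc u -> cyc v ->
  arrow m.+1 p ph q ps -> arrow m.+1 u ph v ps.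
Proof.
by move=> vph vps cp cq cu cv h; apply: (rev vps vph cq cp) => //; apply: rev h.
Qed.

Lemma class_base : C th.
Proof. by split=> //; exact: arrow_refl. Qed.

Lemma class_arrow p ph q ps : C ph -> C ps -> cyc p -> cyc q -> arrow m.+1 p ph q ps.
Proof.
move=> [vph hph] [vps hps] cp cq; apply: (@arrow_trans _ _ _ T_cont _ _ _ x th).
  by apply: rev hph.
exact: (arrow_all _ _ cx cx _ _ hps).
Qed.

Lemma class_shift ph : C ph -> C (shift ph).
Proof.
move=> [vph hph]; have vs := vanishing_shift vph; split=> //.
apply: (arrow_all (p := x) (q := T x)) => //; first exact: cyclicT.
by apply: arrow_trans hph _ => //; exact: arrow_step.
Qed.

Lemma class_iter n ph : C ph -> C (iter n sh ph).
Proof. by move=> Cph; elim: n => //= n; exact: class_shift. Qed.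

Lemma step_dichotomy :
  (forall y t y', states y -> states y' -> fiber_reaches T m y t y') \/
  exists2 k : nat, (0 < k)%N & exists F : _ -> _ -> R,
    forall y y' t, states y -> states y' ->
      (fiber_reaches T m y t y' <-> ang (k%:R * t - F y y') = 0).
Proof.
apply: circle_cocycle.
- by move=> y t y' _ _; exact: fiber_reaches_closed.
- by move=> y _; exact: arrow_refl.
- by move=> y s y' t y'' _ _ _; exact: fiber_reaches_trans.
- move=> [p ph] [q ps] [/= cp Cp] [/= cq Cq].
  by apply: fiber_reaches_some; exact: class_arrow.
Qed.

Section Cocycle.
Variables (k : nat) (F : X * (nat -> R) -> X * (nat -> R) -> R).
Hypothesis k_gt0 : (0 < k)%N.
Hypothesis FP : forall y y' t, states y -> states y' ->
      (fiber_reaches T m y t y' <-> ang (k%:R * t - F y y') = 0).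

Let Fadd y1 y2 y3 : states y1 -> states y2 -> states y3 ->
  ang (F y1 y2 + F y2 y3 - F y1 y3) = 0.
Proof.
apply: (cocycle_add _ k_gt0 FP) => a s b t c _ _ _.
exact: fiber_reaches_trans.
Qed.

Let sO : states (x, th).
Proof. by split; [exact: cx|exact: class_base]. Qed.

Let Fnear y e : states y -> 0 < e ->
  \forall y' \near state_nbhs m.+1 y, states y' -> ang (F (x, th) y' - F (x, th) y) < e.
Proof.
move=> sy e0; apply: (cocycle_near k_gt0 FP sO sy) => // t.
exact: not_fiber_reaches.
Qed.

Lemma cocycle_shift p q ph : cyc p -> cyc q -> C ph ->
  ang (F (T p, shift ph) (T q, shift ph) - F (p, ph) (q, ph)) = 0.
Proof.
move=> cp cq Cph; have Cs := class_shift Cph.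
have [t At tE] := @cocycle_attained _ _ _ _ _ _ k_gt0 FP (p, ph) (q, ph)
  (st cp Cph) (st cq Cph).
have := fiber_reaches_shift T_cont At; rewrite addrK.
move=> /(FP _ (st (cyclicT cp) Cs) (st (cyclicT cq) Cs)) tE'.
apply: etrans (ang_eq0B tE tE').
by congr ang; ring.
Qed.

Lemma cocycle_iter n p q ph : cyc p -> cyc q -> C ph ->
  ang (F (iter n T p, iter n sh ph) (iter n T q, iter n sh ph) -
       F (p, ph) (q, ph)) = 0.
Proof.
move=> cp cq Cph; elim: n => [|n IHn]; first by rewrite subrr ang0.
have h := cocycle_shift (cyclic_iter n cp) (cyclic_iter n cq) (class_iter n Cph).
apply: etrans (ang_eq0D h IHn).
by congr ang; rewrite /=; ring.
Qed.

(** Write [p = a(T) x] and [q = b(T) x] and follow the dynamics from [(x, ph)]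
until it comes close to [(x, ps)]: then [T^n p = a(T) T^n x] is close to [p],
and [T^n q] to [q].  The cocycle between them does not change along the orbit,
and it is continuous. *)
Lemma cocycle_class p q ph ps : cyc p -> cyc q -> C ph -> C ps ->
  ang (F (p, ph) (q, ph) - F (p, ps) (q, ps)) = 0.
Proof.
move=> cp cq Cph Cps; apply/le_anti/andP; split; last exact: ang_ge0.
apply/ler_addgt0Pl => e e0; rewrite addr0.
have e2 : 0 < e / 2 by rewrite divr_gt0.
have [a a0 pE] := cp; have [b b0 qE] := cq.
have [U [d [/= pU d0 hU]]] := Fnear (y := (p, ps)) (st cp Cps) e2.
have [V [d' [/= qV d'0 hV]]] := Fnear (y := (q, ps)) (st cq Cps) e2.
have xU : nbhs x [set z | U (poly_action T a z)].
  by rewrite pE in pU; exact: poly_action_continuous pU.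
have xV : nbhs x [set z | V (poly_action T b z)].
  by rewrite qE in qV; exact: poly_action_continuous qV.
have dd : 0 < Num.min d d' by rewrite lt_min d0.
have [n [[/= Un Vn] nclose]] := class_arrow Cph Cps cx cx (filterI xU xV) dd.
rewrite !poly_action_iter -?pE -?qE in Un Vn.
have cn := class_iter n Cph.
have sp : states (iter n T p, iter n sh ph) by split=> //; exact: cyclic_iter.
have sq : states (iter n T q, iter n sh ph) by split=> //; exact: cyclic_iter.
have h1 : ang (F (x, th) (iter n T p, iter n sh ph) - F (x, th) (p, ps)) < e / 2.
  by apply: hU => // i /nclose; rewrite lt_min => /andP[].
have h2 : ang (F (x, th) (iter n T q, iter n sh ph) - F (x, th) (q, ps)) < e / 2.
  by apply: hV => // i /nclose; rewrite lt_min => /andP[].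
have h3 := cocycle_iter n cp cq Cph.
have h4 := Fadd sO sp sq.
have h5 := Fadd sO (st cp Cps) (st cq Cps).
rewrite (@ang_cong _ _ ((F (x, th) (iter n T q, iter n sh ph) - F (x, th) (q, ps)) -
  (F (x, th) (iter n T p, iter n sh ph) - F (x, th) (p, ps)))).
  by apply: (le_trans (ang_le_add _ _)); rewrite angN; lra.
apply: etrans (ang_eq0D (ang_eq0B h4 h3) (ang_eq0B (_ : ang 0 = 0) h5)).
  by congr ang; ring.
exact: ang0.
Qed.

(** [r (T u) - r (T x)] is the cocycle from [T x] to [T u], which by the two
invariances equals the one from [x] to [u], that is [r u].  So [r] is an
eigenfunction, and recurrence forces its eigenvalue [r (T x)] to be 0 modulo
2 pi. *)
Lemma cocycle_trivial p q ph : cyc p -> cyc q -> C ph ->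
  ang (F (p, ph) (q, ph)) = 0.
Proof.
move=> cp cq Cph; pose r v := F (x, th) (v, th).
have Cth := class_base.
have rE u v : cyc u -> cyc v -> ang (r v - r u - F (u, th) (v, th)) = 0.
  move=> cu cv; have h := Fadd sO (st cu Cth) (st cv Cth).
  rewrite -angN; apply: etrans h; congr ang; rewrite /r; ring.
have rc v : cyc v -> forall e, 0 < e ->
    \forall v' \near v, cyc v' -> ang (r v' - r v) < e.
  move=> cv e e0; have [U [d [/= vU d0 hU]]] := Fnear (st cv Cth) e0.
  apply: filterS vU => v' Uv' cv'; apply: (hU v' th Uv' _ (st cv' Cth)) => i _.
  by rewrite subrr ang0.
have mu0 : ang (r (T x)) = 0.
  apply: (return_eigenphase rc) => [u cu|U xU]; last first.
    have [n Un] := cyclic_orbit_dense (cyclicT cx) xU.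
    by exists n.+1 => //; rewrite iterSr.
  have h1 := rE _ _ (cyclicT cx) (cyclicT cu).
  have h2 := rE _ _ cx cu.
  have h3 := cocycle_shift cx cu Cth.
  have h4 := cocycle_class (cyclicT cx) (cyclicT cu) Cth (class_shift Cth).
  have h5 := Fadd sO sO sO.
  apply: etrans (ang_eq0B (ang_eq0D (ang_eq0D h1 h4) h3) (ang_eq0D h5 h2)).
  by congr ang; rewrite /r; ring.
have riter n : ang (r (iter n T x)) = 0.
  elim: n => [|n IHn].
    by have := Fadd sO sO sO; rewrite addrK.
  have cn := cyclic_iter n cx.
  have h1 := rE _ _ (cyclicT cx) (cyclicT cn).
  have h2 := rE _ _ cx cn.
  have h3 := cocycle_shift cx cn Cth.
  have h4 := cocycle_class (cyclicT cx) (cyclicT cn) Cth (class_shift Cth).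
  have h5 := Fadd sO sO sO.
  have h := ang_eq0B (ang_eq0D (ang_eq0D h1 h4) h3) (ang_eq0D h5 h2).
  apply: etrans (ang_eq0D (ang_eq0D h mu0) IHn).
  by congr ang; rewrite /r /=; ring.
have r0 v : cyc v -> ang (r v) = 0.
  move=> cv; apply/le_anti/andP; split; last exact: ang_ge0.
  apply/ler_addgt0Pl => e e0; rewrite addr0.
  have [n /= /(_ (cyclic_iter n cx)) h] := cyclic_orbit_dense cx (rc v cv e e0).
  have := ang_triangle (r (iter n T x)) (r v) 0.
  rewrite !subr0 riter addr0 angB => h'; exact: le_trans (ltW h).
have h1 := cocycle_class cp cq Cph Cth.
have h2 := rE _ _ cp cq.
apply: etrans (ang_eq0D (ang_eq0B h1 h2) (ang_eq0B (r0 _ cq) (r0 _ cp))).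
by congr ang; ring.
Qed.
End Cocycle.

(** With a trivial cocycle over each phase, the rotation from [th] to [ph] and
the one from [ph] to [th] are opposite up to self-rotations, whatever the cyclic
vectors are. *)
Lemma step_reverse ph u v w z : van ph -> cyc u -> cyc v -> cyc w -> cyc z ->
  arrow m u th v ph -> arrow m z ph w th.
Proof.
move=> vph cu cv cw cz uv.
have Cth := class_base.
have Cph : C ph.
  by split=> //; apply: (arrow_all (p := u) (q := v)) => //; exact: arrow_weaken.
apply/fiber_reachesP.
have [all|[k k0 [F FP]]] := step_dichotomy; first exact: all.
apply/(FP _ _ _ (st cz Cph) (st cw Cth)).
have suv : states (u, th) by split.
have svv : states (v, ph) by split.
have szz : states (z, ph) by split.
have sww : states (w, th) by split.
have Fadd a b c : states a -> states b -> states c ->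
    ang (F a b + F b c - F a c) = 0.
  apply: (cocycle_add _ k0 FP) => a' s b' t c' _ _ _.
  exact: fiber_reaches_trans.
move/fiber_reachesP/(FP _ _ _ suv svv) : uv => h1.
have h2 := cocycle_trivial k0 FP cv cz Cph.
have h3 := cocycle_trivial k0 FP cw cu Cth.
have h4 := Fadd _ _ _ suv svv szz.
have h5 := Fadd _ _ _ suv szz sww.
have h6 := Fadd _ _ _ suv sww suv.
have h7 := Fadd _ _ _ suv suv suv.
rewrite -angN.
apply: etrans (ang_eq0D (ang_eq0D h1 (ang_eq0D h4 h5))
  (ang_eq0D (ang_eq0D h6 h7) (ang_eq0D (ang_eq0B (ang0 R) h2) (ang_eq0B (ang0 R) h3)))).
by congr ang; ring.
Qed.
End Step.

Lemma reversible_sub n : reversible (D - n).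
Proof.
elim: n => [|n IHn]; first by rewrite subn0; exact: reversible_top.
have [Dn|nD] := leqP D n.
  by rewrite (_ : D - n.+1 = D - n)%N //; lia.
move=> th ph u v w z vth vph cu cv cw cz.
apply: (step_reverse _ vth vph) => //.
by rewrite subnS prednK ?subn_gt0.
Qed.

(** Symmetry applied to the trivial arrow from [(x, th)] to itself shows that
[(w, th)] is reachable for every cyclic [w], here chosen with
[cis (th 0) *: w] close to [v]. *)
Lemma rotated_orbit_dense th v U : van th -> nbhs v U ->
  exists n, U (cis (iter n sh th 0%N) *: iter n T x).
Proof.
move=> vth; rewrite nbhsE => -[V [Vo Vv] VU].
have cf : (cis (th 0%N) *: z) @[z --> cis (- th 0%N) *: v] --> v.
  rewrite -[X in _ --> X]scale1r -(cisN_mul (th 0%N)) mulrC -scalerA.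
  by apply: cvgXZr; exact: cvg_id.
have cx := cyclic_base T x.
have [l /= Vl] := cyclic_orbit_dense cx (cf _ (open_nbhs_nbhs (conj Vo Vv))).
have cl := cyclic_iter l cx.
have [[A B] /= [At Bl] AB] := rotate_near (open_nbhs_nbhs (conj Vo Vl)).
have [e e0 he] := ang_near_rep At.
have rev0 : reversible 0 by have := @reversible_sub D; rewrite subnn.
have [n [Bn nclose]] := rev0 _ _ _ _ _ _ vth vth cx cx cl cx
  (@arrow_refl _ _ T 0 x th) _ _ Bl e0.
have [s ss As] := he _ (nclose 0%N (leqnn _)).
exists n; apply: VU; rewrite -(cis_ang ss).
exact: (AB (s, _)).
Qed.
End Tower.

(** * Lower density *)

Section Density.
Variable R : realType.
Implicit Types (A B : set nat) (n m k N : nat).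

Definition counting A k : nat := \sum_(1 <= n < k.+1) (n \in A).

Lemma card_counting A k :
  #|` fset_set (A `&` [set n | (1 <= n <= k)%N])| = counting A k.
Proof.
have fin : finite_set (A `&` [set n | (1 <= n <= k)%N]).
  apply: (@sub_finite_set _ _ `I_k.+1); last exact: finite_II.
  by move=> n [_ /andP[_ nk]].
rewrite /counting -big_mkcond /= sum1_count -size_filter.
apply: perm_size; apply: uniq_perm.
- exact: finmap.fset_uniq.
- by rewrite filter_uniq // iota_uniq.
move=> n; rewrite in_fset_set // mem_filter mem_index_iota ltnS in_setI.
by congr (_ && _); apply/idP/idP; rewrite inE.
Qed.

Lemma lower_density_gt0P A : (0 < lower_density R A)%E <->
  exists2 c : R, 0 < c & exists M, forall k, (M <= k)%N ->
    c * k%:R <= (counting A k)%:R.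
Proof.
set u := fun k => ((counting A k)%:R / k%:R : R).
have -> : lower_density R A = ereal_sup (range (einfs (fun k => (u k)%:E))).
  rewrite /lower_density limn_einf_lim.
  under eq_fun do rewrite card_counting.
  by apply/cvg_lim => //; exact: cvg_einfs_sup.
split=> [/ereal_sup_gt[_ [M _ <-]] inf_gt0|[c c0 [M hM]]].
  have [c c0 cinf] : exists2 c : R, 0 < c &
      (c%:E <= einfs (fun k => (u k)%:E) M)%E.
    case: (einfs _ M) inf_gt0 => [c c0| _ |//]; first by exists c.
    by exists 1 => //; rewrite leey.
  exists c => //; exists M.+1 => k Mk; have k0 : 0 < k%:R :> R.
    by rewrite ltr0n (leq_trans _ Mk).
  rewrite -ler_pdivlMr // -lee_fin; apply: (le_trans cinf).
  by apply: ereal_inf_lbound; exists k => //=; exact: ltnW.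
apply: (@lt_le_trans _ _ c%:E); first by rewrite lte_fin.
apply: (@le_trans _ _ (einfs (fun k => (u k)%:E) M.+1)).
  apply: le_ereal_inf_tmp => _ [k /= Mk <-]; rewrite lee_fin /u.
  by rewrite ler_pdivlMr ?hM ?(ltnW Mk) // ltr0n (leq_trans _ Mk).
by apply: ereal_sup_ubound; exists M.+1.
Qed.

(** Each element of [B] comes from at most [N + 1] elements of [A], whence
[counting A k <= (N + 1) * counting B (k + N)]. *)
Lemma lower_density_translate A B N :
  (forall n, A n -> exists2 m, (m <= N)%N & B (m + n)%N) ->
  (0 < lower_density R A)%E -> (0 < lower_density R B)%E.
Proof.
move=> AB /lower_density_gt0P[c c0 [M hM]]; apply/lower_density_gt0P.
have AleB k : (counting A k <= N.+1 * counting B (k + N))%N.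
  rewrite /counting.
  apply: (@leq_trans (\sum_(1 <= n < k.+1) \sum_(m < N.+1) (m + n \in B))%N).
    apply: leq_sum => n _; have [nA|//] := boolP (n \in A).
    have [m mN /mem_set mB] := AB n (set_mem nA).
    by rewrite (bigD1 (Ordinal (mN : (m < N.+1)%N))) //= mB.
  rewrite exchange_big /= -[X in (_ <= X * _)%N]card_ord -sum_nat_const.
  apply: leq_sum => m _.
  have mN : (m <= N)%N by rewrite -ltnS.
  have -> : (\sum_(1 <= n < k.+1) (m + n \in B) =
      \sum_(1 + m <= n < k.+1 + m) (n \in B))%N.
    by rewrite big_addn addnK; apply: eq_bigr => n _; rewrite addnC.
  rewrite [leqRHS](@big_cat_nat _ _ _ (1 + m)) ?leq_addr //=; last by lia.
  rewrite [X in (_ <= _ + X)%N](@big_cat_nat _ _ _ (k.+1 + m)) /=; [|by lia|by lia].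
  by rewrite addnCA leq_addr.
(* The factor 2 absorbs the shift by N, as k <= 2 (k - N) for k >= 2 N. *)
exists (c / (2 * N.+1%:R)); first by rewrite divr_gt0 // mulr_gt0 // ltr0n.
exists (M + N + N)%N => k Mk.
have [j kE] : exists j, k = (j + N)%N by exists (k - N)%N; lia.
have jM : (M <= j)%N by lia.
have jN : k%:R <= 2 * j%:R :> R by rewrite -natrM ler_nat; lia.
have N0 : 0 < 2 * N.+1%:R :> R by rewrite mulr_gt0 // ltr0n.
rewrite mulrAC ler_pdivrMr //.
have h1 := hM _ jM.
have h2 : (counting A j)%:R <= N.+1%:R * (counting B k)%:R :> R.
  by rewrite -natrM ler_nat kE.
have h3 : c * k%:R <= c * (2 * j%:R) by rewrite ler_pM2l.
apply: (le_trans h3); rewrite [_ * (2 * _)]mulrCA [leRHS]mulrC -mulrA ler_pM2l //.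
exact: le_trans h2.
Qed.

Lemma lower_density_nonempty A : (0 < lower_density R A)%E -> exists n, A n.
Proof.
move=> /lower_density_gt0P[c c0 [M hM]]; apply: contrapT => /forallNP A0.
have : 0 < c * M.+1%:R by rewrite mulr_gt0 // ltr0n.
rewrite ltNge => /negP; apply; apply: (le_trans (hM _ (leqnSn M))).
rewrite /counting big1 // => n _; case: (boolP (n \in A)) => //.
by move=> /set_mem /A0.
Qed.
End Density.

(** * From density to positive lower density *)

Section PolynomialPhase.
Variable R : realType.
Implicit Types (P : {poly R}) (n i : nat).

Definition difference P : {poly R} := P \Po ('X + 1%:P) - P.

Lemma size_difference P : (size (difference P) <= (size P).-1)%N.
Proof.
have s2 : size ('X + 1%:P : {poly R}) = 2 by rewrite size_XaddC.
have [->|P0] := eqVneq P 0; first by rewrite /difference comp_poly0 subrr size_poly0.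
have sP : size (P \Po ('X + 1%:P)) = size P by rewrite size_comp_poly2.
apply/leq_sizeP => i; rewrite leq_eqVlt => /orP[/eqP <-|iP].
  rewrite /difference coefB -{1}sP -!lead_coefE lead_coef_comp ?s2 //.
  by rewrite lead_coefXaddC expr1n mulr1 subrr.
by rewrite /difference coefB !nth_default ?subrr ?sP //; move: iP; case: size.
Qed.

Lemma horner_difference P a : (difference P).[a] = P.[a + 1] - P.[a].
Proof. by rewrite /difference hornerD hornerN horner_comp !hornerE. Qed.

Definition phases P : nat -> R := fun i => (iter i difference P).[0].

Lemma iter_shift_phases P n i :
  iter n (@shift R) (phases P) i = (iter i difference P).[n%:R].
Proof.
elim: n i => [//|n IHn] i; rewrite /= /shift !IHn /=.
by rewrite horner_difference natr1 addrC subrK.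
Qed.

Lemma phases_vanishing P : vanishing (size P) (phases P).
Proof.
move=> i Pi; rewrite /phases; suff -> : iter i difference P = 0 by rewrite horner0.
apply/eqP; rewrite -size_poly_eq0 -leqn0.
have : (size (iter i difference P) <= size P - i)%N.
  elim: i {Pi} => [|i IHi]; first by rewrite subn0.
  rewrite subnS; apply: leq_trans (size_difference _) _.
  by rewrite -!subn1 leq_sub2r.
by move=> h; apply: leq_trans h _; rewrite leqn0 subn_eq0.
Qed.

Lemma expC_cis (a : R) : expC ('i%C * a%:C%C) = cis a.
Proof. by rewrite /expC /= !mul0r !mul1r subrr add0r expR0 mul1r. Qed.
End PolynomialPhase.

Section Uniform.
Import ArrowAsProduct.
Variables (R : realType) (X : topologicalLmodType R[i]) (T : {linear X -> X}).
Hypothesis T_cont : continuous T.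
Variable x : X.
Hypothesis x_dense : rotated_dense T x.

Lemma iter_shift_continuous n i :
  continuous (fun th : nat -> R => iter n (@shift R) th i).
Proof.
elim: n i => [|n IHn] i th; first exact: (@proj_continuous _ (fun=> R) i th).
exact: (cvgD (IHn i th) (IHn i.+1 th)).
Qed.

Lemma iter_shift_ang n (th ph : nat -> R) : (forall i, ang (th i - ph i) = 0) ->
  forall i, ang (iter n (@shift R) th i - iter n (@shift R) ph i) = 0.
Proof.
move=> h; elim: n => [//|n IHn] i /=.
by apply: etrans (ang_eq0D (IHn i) (IHn i.+1)); congr ang; rewrite /shift; ring.
Qed.

(** The residues of a vanishing sequence range over a product of [D] compact
intervals, and the conclusion holds with a single [m] near each of its
points. *)
Lemma uniform_return D (v : X) U : nbhs v U -> open U ->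
  exists N V, [/\ open V, V x & forall y th, V y -> vanishing D th ->
    exists2 m, (m <= N)%N & U (cis (iter m (@shift R) th 0%N) *: iter m T y)].
Proof.
move=> vU Uo.
pose box i : set R := if (i < D)%N then `[0, pi *+ 2]%classic else [set 0].
have /compact_near_coveringP cov : compact [set f : nat -> R | forall i, box i (f i)].
  apply: (@tychonoff _ (fun=> R) box) => i; rewrite /box; case: ifP => _.
    exact: segment_compact.
  exact: compact_set1.
pose P (z : X * nat) th := exists2 m, (m <= z.2)%N &
  U (cis (iter m (@shift R) th 0%N) *: iter m T z.1).
have hP th : [set f : nat -> R | forall i, box i (f i)] th ->
    \forall th' \near th & z \near filter_prod (nbhs x) \oo, P z th'.
  move=> hth; have vth : vanishing D th.
    by move=> i Di; have := hth i; rewrite /box ltnNge Di.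
  have [m Um] := rotated_orbit_dense T_cont x_dense vth vU.
  have [[A B] /= [At Bx] AB] := rotate_near (open_nbhs_nbhs (conj Uo Um)).
  have nA : nbhs th [set th' | A (iter m (@shift R) th' 0%N)].
    exact: iter_shift_continuous At.
  have nB : nbhs x [set y | B (iter m T y)] by exact: iter_continuous Bx.
  have nC : filter_prod (nbhs x) \oo [set z | B (iter m T z.1) /\ (m <= z.2)%N].
    exists ([set y | B (iter m T y)], [set N | (m <= N)%N]); first split => //=.
      exact: nbhs_infty_ge.
    by move=> [y N] [].
  apply: (near2I nA nC) => th' z /= Ath [Bz mz].
  by exists m => //; exact: (AB (_, _)).
have [[A B] /= [Ax [N _ BN]] AB] : \forall z \near filter_prod (nbhs x) \oo,
  [set f : nat -> R | forall i, box i (f i)] `<=` P z by exact: cov hP.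
move: Ax; rewrite nbhsE => -[V [Vo Vx] VA].
exists N, V; split=> // y th Vy vth.
have [red redP] : {g : nat -> R & forall i, box i (g i) /\ ang (g i - th i) = 0}.
  apply: (@choice _ _ (fun i t => box i t /\ ang (t - th i) = 0)) => i.
  rewrite /box; case: (ltnP i D) => iD.
    by have [s sth s02] := ang_reduce (th i); exists s; split=> //=; rewrite in_itv.
  by exists 0; split=> //; rewrite vth // subrr ang0.
have [m mN Um] := AB (y, N) (conj (VA _ Vy) (BN _ (leqnn N))) red
  (fun i => (redP i).1).
exists m => //; rewrite -(@cis_ang _ (iter m (@shift R) red 0%N)) //.
by apply: iter_shift_ang => i; exact: (redP i).2.
Qed.
End Uniform.

Theorem theorem1p2 (R : realType) (X : topologicalLmodType R[i])
    (T : {linear X -> X}) (T_cont : continuous T) (x : X) :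
  [<-> frequently_hypercyclic T x;
       forall (P : {poly R}) (U : set X), open U -> U !=set0 ->
         (0 < lower_density R
                [set n | U (expC ('i%C * P.[n%:R]%:C%C)%R *: iter n T x)])%E;
       exists P : {poly R}, forall U : set X, open U -> U !=set0 ->
         (0 < lower_density R
                [set n | U (expC ('i%C * P.[n%:R]%:C%C)%R *: iter n T x)])%E].
Proof.
tfae.
- move=> fhc P U Uo [v Uv].
  have dx : rotated_dense T x.
    move=> w W0; rewrite nbhsE => -[W [Wo Ww] WW0].
    have [n Wn] := lower_density_nonempty (fhc W Wo (ex_intro _ w Ww)).
    by exists n, 0; rewrite cis0 scale1r; exact: WW0.
  have [N [V [Vo Vx UV]]] := uniform_return T_cont dx (size P)
    (open_nbhs_nbhs (conj Uo Uv)) Uo.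
  apply: (@lower_density_translate R _ _ N _ (fhc V Vo (ex_intro _ x Vx))) => n /= Vn.
  have [m mN Um] := UV _ _ Vn (vanishing_iter n (@phases_vanishing _ P)).
  exists m => //; rewrite /mkset expC_cis.
  by move: Um; rewrite -!iterD iter_shift_phases.
- by move=> h; exists 0; exact: h.
- move=> [P hP] U Uo [v Uv].
  have dx : rotated_dense T x.
    move=> w W0; rewrite nbhsE => -[W [Wo Ww] WW0].
    have [n Wn] := lower_density_nonempty (hP W Wo (ex_intro _ w Ww)).
    by exists n, P.[n%:R]; rewrite -expC_cis; exact: WW0.
  have [N [V [Vo Vx UV]]] := uniform_return T_cont dx 1
    (open_nbhs_nbhs (conj Uo Uv)) Uo.
  apply: (@lower_density_translate R _ _ N _ (hP V Vo (ex_intro _ x Vx))) => n.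
  rewrite /mkset expC_cis => Vn.
  (* the phase constantly equal to - P(n), to undo the rotation at time n *)
  pose th i : R := if i == 0%N then - P.[n%:R] else 0.
  have vth : vanishing 1 th by move=> [].
  have [m mN Um] := UV _ _ Vn vth; exists m => //=.
  have thE : iter m (@shift R) th 0%N = - P.[n%:R].
    suff h i : iter m (@shift R) th i = th i by rewrite h.
    elim: m i {mN Um} => //= m IHm i.
    by rewrite /shift !IHm {2}/th addr0.
  by move: Um; rewrite thE iterTZ scalerA cisN_mul scale1r -iterD.
Qed.
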